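(* Let $\mathsf S$ be a simple polytope and let $\mathrm B$ be a building set for $\mathsf S$. Then $\mathcal T_{\mathrm B}(\mathsf S)$ is a full-dimensional open polyhedral cone contained in $\operatorname{Def}(\Gamma_{\mathrm B})$.
   Context: Conventions. Let $\Lambda$ be a lattice (by default $\mathbb Z^n\subset\mathbb R^n$) and $V=\Lambda\otimes\mathbb R$. Polytopes live in $V$; normal vectors live in $V^*$, which contains the dual lattice $\Lambda^*$ (for $\mathbb R^n$ identified via the dot product). All polytopes have rational facet normals. $h(\mathsf P,u)=\min_{x\in\mathsf P}u\cdot x$. The normal fan $\Sigma(\mathsf P)$ is the collection of normal cones $\{u : u\cdot x=h(\mathsf P,u)\ \forall x\in\mathsf F\}$ of nonempty faces $\mathsf F$; its lineality space is $\mathsf L=\{w : w\cdot x\text{ constant on }\mathsf P\}$. A fan coarsens another if each of its cones is a union of cones of the other. Face normals. For a facet $\mathsf G$ of $\mathsf S$, $u_{\mathsf G}\in\Lambda^*$ is a fixed inner normal whose image in $\Lambda^*/(\Lambda^*\cap\mathsf L)$ is primitive; for a nonempty proper face $\mathsf F$, $u_{\mathsf F}=\sum_{\mathsf G\supseteq\mathsf F}u_{\mathsf G}$ over the facets containing $\mathsf F$. Truncations. $\operatorname{Tr}_\epsilon[\mathsf S,\mathsf F]=\{x\in\mathsf S : u_{\mathsf F}\cdot x\ge h(\mathsf S,u_{\mathsf F})+\epsilon\}$. It is shallow if $0<\epsilon<\min_y(u_{\mathsf F}\cdot y-h(\mathsf S,u_{\mathsf F}))$, the minimum over vertices $y\notin\mathsf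 F$ joined by an edge to a vertex of $\mathsf F$. Building sets. A set $\mathrm B$ of nonempty proper faces of a simple polytope $\mathsf S$ is a building set for $\mathsf S$ if (1) it contains all facets; (2) whenever $\mathsf F,\mathsf G\in\mathrm B$ satisfy $\mathsf F\cap\mathsf G\ne\emptyset$ and some facet contains both, then $\mathsf F\cap\mathsf G\in\mathrm B$. $\mathrm B$-truncation. List $\mathrm B$ as $\mathsf F_1,\dots,\mathsf F_m$ in an order extending inclusion (smaller faces first), let $\mathsf S_0=\mathsf S$, and for numbers $\epsilon_{\mathsf F}>0$ let $\mathsf S_i=\operatorname{Tr}_{\epsilon_{\mathsf F_i}}[\mathsf S_{i-1},\mathsf F_i\cap\mathsf S_{i-1}]$ (direction $u_{\mathsf F_i}$). If each truncation is shallow, $\mathsf S_m$ is a $\mathrm B$-truncation of $\mathsf S$. $\mathcal T_{\mathrm B}(\mathsf S)=\{\lambda\mathsf P+v : \lambda>0,\ v\in V,\ \mathsf P\text{ a }\mathrm B\text{-truncation of }\mathsf S\}$, polytopes being identified with their support functions. The fan $\Gamma_{\mathrm B}$. For a simplicial fan $\Sigma$ and a cone $\sigma\in\Sigma$ with canonical interior vector $u_\sigma$ (the sum of its primitive ray generators; $u_\sigma=u_{\mathsf F}$ for $\sigma$ the normal cone of $\mathsf F$), the central stellar subdivision along $\sigma$ removes all cones containing $\sigma$ and adds $\operatorname{Cone}(\{u_\sigma\}\cup\nu)$ for all $\nu$ that are faces of cones containing $\sigma$ but do not themselves contain $\sigma$ (performed modulo the lineality space, which is then added back to every cone). $\Gamma_{\mathrm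 B}$ is obtained from $\Sigma(\mathsf S)$ by successive central stellar subdivisions along the normal cones of the faces in $\mathrm B$, larger cones first. It is the normal fan of any $\mathrm B$-truncation of $\mathsf S$. Deformation cone. $\operatorname{PL}(\Gamma_{\mathrm B})$ is the vector space of functions on $V^*$ linear on each cone; $\operatorname{Def}(\Gamma_{\mathrm B})\subseteq\operatorname{PL}(\Gamma_{\mathrm B})$ is the cone of support functions of polytopes whose normal fan coarsens $\Gamma_{\mathrm B}$. Open and full-dimensional refer to $\operatorname{PL}(\Gamma_{\mathrm B})$; an open polyhedral cone is one cut out by finitely many strict homogeneous linear inequalities. *)

(* Defs.v *)
From mathcomp Require Import all_boot all_order all_algebra.
From mathcomp Require Import all_classical all_reals.
Set Implicit Arguments.
Unset Strict Implicit.
Unset Printing Implicit Defensive.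
Import Order.TTheory GRing.Theory Num.Theory.
Local Open Scope classical_set_scope.
Local Open Scope ring_scope.

(* V = 'rV[R]_n, and V^* is identified with 'rV[R]_n through the dot product.
   A lattice is given by a basis of V, the rows of M : 'M[R]_n; the identity
   matrix gives Z^n. *)

Section Polytopes.
Variables (R : realType) (n : nat).
Local Notation V := 'rV[R]_n.
Implicit Types (M : 'M[R]_n) (P F G K : set V) (u w x : V).

Definition dotp u x : R := \sum_(i < n) u 0 i * x 0 i.

Definition lattice M : set V := [set map_mx intr z *m M | z in [set: 'rV[int]_n]].

Definition dual_lattice M : set V :=
  [set u | forall x, lattice M x -> dotp u x \is a Num.int].

Definition hull m (p : 'I_m -> V) : set V :=
  [set x | exists a : 'I_m -> R, [/\ forall i, 0 <= a i, \sum_i a i = 1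
                                   & x = \sum_i a i *: p i]].

(* On a polytope the infimum is attained. *)
Definition supp P u : R := inf [set dotp u x | x in P].

Definition direction P : {vspace V} :=
  xget 0%VS [set U : {vspace V} |
    (forall x y, P x -> P y -> x - y \in U) /\
    (forall W : {vspace V}, (forall x y, P x -> P y -> x - y \in W) ->
       (U <= W)%VS)].

Definition adim P : nat := \dim (direction P).

(* Nonempty faces of a polyhedron K (K itself included). This is also used for
   the cones of a fan: there the only possible c is 0. *)
Definition face K F : Prop :=
  F !=set0 /\ exists w c, (forall x, K x -> c <= dotp w x) /\
                          F = [set x | K x /\ dotp w x = c].

Definition facet P G : Prop := face P G /\ (adim G).+1 = adim P.

Definition vertex P x : Prop := face P [set x].

Definition adjacent P x y : Prop :=
  x <> y /\ exists E, [/\ face P E, adim E = 1%N, E x & E y].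

Definition normal_cone P F : set V :=
  [set u | forall x, F x -> dotp u x = supp P u].

Definition lineality P : set V :=
  [set w | forall x y, P x -> P y -> dotp w x = dotp w y].

Definition normal_fan P : set (set V) := normal_cone P @` face P.

Definition coarsens (Sigma Gamma : set (set V)) : Prop :=
  forall s, Sigma s -> exists2 A, A `<=` Gamma & s = \bigcup_(t in A) t.

Definition polytope M P : Prop :=
  (exists m (p : 'I_m.+1 -> V), P = hull p) /\
  (forall G, facet P G ->
     exists u, [/\ dual_lattice M u, normal_cone P G u & ~ lineality P u]).

Definition simple_polytope M P : Prop :=
  polytope M P /\
  forall x, vertex P x -> ([set G | facet P G /\ G x] #= `I_(adim P))%card.

(* The last condition says that the image of nu G in Lambda^* modulo
   Lambda^* `&` lineality P is primitive; the case k = 0 makes it nonzero. *)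
Definition facet_normals M P (nu : set V -> V) : Prop :=
  forall G, facet P G ->
    [/\ dual_lattice M (nu G), normal_cone P G (nu G)
      & forall (k : nat) w, dual_lattice M w ->
          lineality P (nu G - w *+ k) -> k = 1%N].

Definition face_normal P (nu : set V -> V) F : V :=
  \sum_(G \in [set G | facet P G /\ F `<=` G]) nu G.

Definition truncation (eps : R) P w : set V :=
  [set x | P x /\ supp P w + eps <= dotp w x].

Definition shallow (eps : R) P F w : Prop :=
  0 < eps /\
  forall x y, vertex P x -> F x -> vertex P y -> ~ F y -> adjacent P x y ->
    eps < dotp w y - supp P w.

Definition building_set S (B : set (set V)) : Prop :=
  [/\ forall F, B F -> face S F /\ F <> S,
      facet S `<=` B
    & forall F G, B F -> B G -> F `&` G !=set0 ->
        (exists H, [/\ facet S H, F `<=` H & G `<=` H]) -> B (F `&` G)].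

Definition inclusion_listing (B : set (set V)) (s : seq (set V)) : Prop :=
  [/\ uniq s, B = [set` s]
    & forall F G, F \in s -> G \in s -> F `<=` G ->
        (index F s <= index G s)%N].

Fixpoint shallow_truncations S nu (eps : set V -> R) (s : seq (set V)) P Q :
    Prop :=
  if s is F :: s' then
    let w := face_normal S nu F in
    shallow (eps F) P (F `&` P) w /\
    shallow_truncations S nu eps s' (truncation (eps F) P w) Q
  else Q = P.

(* Here s is the chosen listing of B. The set of B-truncations depends on it:
   exchanging two incomparable faces can turn a shallow truncation into one
   that is not. The fan Gamma_fan below does not. *)
Definition B_truncation S nu (s : seq (set V)) P : Prop :=
  exists eps : set V -> R, shallow_truncations S nu eps s S P.

Definition T_cone S nu (s : seq (set V)) : set (V -> R) :=
  [set f | exists (lambda : R) v P,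
     [/\ 0 < lambda, B_truncation S nu s P
       & f = supp [set lambda *: x + v | x in P]]].

(* Cone({w} `|` t) for a convex cone t. *)
Definition cone_add w (t : set V) : set V :=
  [set y | exists a x, [/\ 0 <= a, t x & y = a *: w + x]].

(* All cones of Gamma contain its lineality space, so that subdividing modulo
   the lineality space and adding it back is subdividing in V^*. *)
Definition stellar (Gamma : set (set V)) (sigma : set V) w : set (set V) :=
  [set t | Gamma t /\ ~ sigma `<=` t] `|`
  [set cone_add w t | t in
     [set t | ~ sigma `<=` t /\
              exists k, [/\ Gamma k, sigma `<=` k & face k t]]].

(* face_normal S nu F is the canonical interior vector of normal_cone S F, and
   smaller faces have larger normal cones. *)
Definition stellar_fan S nu (s : seq (set V)) : set (set V) :=
  foldl (fun Gamma F => stellar Gamma (normal_cone S F) (face_normal S nu F))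
        (normal_fan S) s.

Definition Gamma_fan S nu (B Gamma : set (set V)) : Prop :=
  exists2 s, inclusion_listing B s & Gamma = stellar_fan S nu s.

Definition PL (Gamma : set (set V)) : set (V -> R) :=
  [set f | forall s, Gamma s -> exists x, forall u, s u -> f u = dotp u x].

Definition Def_cone M (Gamma : set (set V)) : set (V -> R) :=
  [set f | exists P, [/\ polytope M P, coarsens (normal_fan P) Gamma
                       & f = supp P]].

Definition linear_on (W : set (V -> R)) (l : (V -> R) -> R) : Prop :=
  forall (a : R) f g, W f -> W g ->
    l (fun u => a * f u + g u) = a * l f + l g.

Definition open_polyhedral_cone (W C : set (V -> R)) : Prop :=
  exists m (l : 'I_m -> (V -> R) -> R),
    (forall i, linear_on W (l i)) /\
    C = [set f | W f /\ forall i, 0 < l i f].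

Definition full_dimensional (W C : set (V -> R)) : Prop :=
  C !=set0 /\
  forall f, W f -> exists m (a : 'I_m -> R) (g : 'I_m -> V -> R),
    (forall i, C (g i)) /\ f = (fun u => \sum_i a i * g i u).

End Polytopes.

(* Main.v *)
(* The normal fan of a polytope is recorded by an abstract simplicial complex D on
   a set of normals u_i. Shallow truncation of a face performs a stellar
   subdivision on D, and for a building set the resulting complex is the complex of
   nested sets, whatever the listing. At each step shallowness amounts to finitely
   many strict inequalities, linear in the depths chosen so far, saying that u_F
   exceeds the cutting level at the vertices off F. Hence f lies in T_B(S) iff it is
   piecewise linear on the final fan and, for some scaling factor lambda > 0 and
   some translation, the values f(u_F) satisfy finitely many strict linear
   inequalities in (f, lambda, translation); eliminating the parameters by
   Fourier-Motzkin leaves an open polyhedral cone. It is nonempty since the depths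
   can be chosen successively small enough, hence full-dimensional.
   That the simple polytope S itself is described by such a complex follows from
   Farkas' lemma: normals decompose along facet normals, and at a vertex in exactly
   dim S facets the facet normals are independent. *)
Require Import Defs.
From mathcomp Require Import all_boot all_order all_algebra.
From mathcomp Require Import all_classical all_reals.
From mathcomp Require Import ring lra.
From HB Require Import structures.
Import Order.TTheory GRing.Theory Num.Theory.
Local Open Scope classical_set_scope.
Local Open Scope ring_scope.

Set Implicit Arguments.
Unset Strict Implicit.
Unset Printing Implicit Defensive.

(** * Dot product and the Farkas lemma *)

Section DotProduct.
Variables (R : realType) (n : nat).
Implicit Types u v w x y z : 'rV[R]_n.

(** The obstacle is that shallowness speaks of intermediate polytopes, which depend on the depths,
    while a cone of functions must be described without them. It is overcome because the
    intermediate complexes are known in advance, and because the support numbers of an intermediate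
    polytope are those of S, raised by the depths at the faces already cut. Multiplying by lambda
    makes the system homogeneous: the support numbers of S become coefficients of lambda, and lambda
    times a depth becomes a linear expression in f, lambda and the translation. If S is not
    full-dimensional, f already fixes the translation against the lineality space, and only a
    complementary part of it is a free parameter. The invariant [realizes] carried through the cuts
    mentions neither dimension nor linear independence. Simpliciality is encoded in [rz_strict],
    which cutting segments at the truncation level suffices to preserve. All faces in B, facets
    included, share one finite index type from the beginning; the vector of a face not yet cut is no
    ray of the complex unless the face is a facet. *)

Lemma dotpC u x : dotp u x = dotp x u.
Proof. by apply: eq_bigr => i _; rewrite mulrC. Qed.

Lemma dotpDl u v x : dotp (u + v) x = dotp u x + dotp v x.
Proof. by rewrite -big_split; apply: eq_bigr => i _; rewrite mxE mulrDl. Qed.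

Lemma dotpZl a u x : dotp (a *: u) x = a * dotp u x.
Proof. by rewrite mulr_sumr; apply: eq_bigr => i _; rewrite mxE mulrA. Qed.

Lemma dotpDr u x y : dotp u (x + y) = dotp u x + dotp u y.
Proof. by rewrite !(dotpC u) dotpDl. Qed.

Lemma dotpZr a u x : dotp u (a *: x) = a * dotp u x.
Proof. by rewrite !(dotpC u) dotpZl. Qed.

Lemma dotp0l x : dotp 0 x = 0.
Proof. by rewrite -(scale0r 0) dotpZl mul0r. Qed.

Lemma dotp0r u : dotp u 0 = 0.
Proof. by rewrite dotpC dotp0l. Qed.

Lemma dotpNl u x : dotp (- u) x = - dotp u x.
Proof. by rewrite -scaleN1r dotpZl mulN1r. Qed.

Lemma dotpNr u x : dotp u (- x) = - dotp u x.
Proof. by rewrite !(dotpC u) dotpNl. Qed.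

Lemma dotpBl u v x : dotp (u - v) x = dotp u x - dotp v x.
Proof. by rewrite dotpDl dotpNl. Qed.

Lemma dotpBr u x y : dotp u (x - y) = dotp u x - dotp u y.
Proof. by rewrite dotpDr dotpNr. Qed.

Lemma dotp_suml (I : Type) (r : seq I) (P : pred I) (F : I -> 'rV[R]_n) x :
  dotp (\sum_(i <- r | P i) F i) x = \sum_(i <- r | P i) dotp (F i) x.
Proof.
by elim/big_rec2: _ => [|i a b _ <-]; rewrite ?dotp0l ?dotpDl.
Qed.

Lemma dotp_sumr (I : Type) (r : seq I) (P : pred I) (F : I -> 'rV[R]_n) u :
  dotp u (\sum_(i <- r | P i) F i) = \sum_(i <- r | P i) dotp u (F i).
Proof. by rewrite dotpC dotp_suml; apply: eq_bigr => i _; rewrite dotpC. Qed.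

Lemma dotp_gt0 x : x != 0 -> 0 < dotp x x.
Proof.
move=> x0; have sq i : true -> 0 <= x 0 i * x 0 i by rewrite -expr2 sqr_ge0.
rewrite lt_def sumr_ge0 // andbT; apply: contra x0 => /eqP.
move=> /(psumr_eq0P sq) z.
by apply/eqP/rowP => i; rewrite mxE; apply/eqP; rewrite -sqrf_eq0 expr2 z.
Qed.

Lemma dotp_inj x y : (forall u, dotp u x = dotp u y) -> x = y.
Proof.
move=> h; apply/eqP; rewrite -subr_eq0; apply: contraT => /dotp_gt0.
by rewrite dotpBr h subrr ltxx.
Qed.

Lemma dotp_represents (f : 'rV[R]_n -> R) :
  (forall a u v, f (a *: u + v) = a * f u + f v) ->
  forall u, f u = dotp u (\row_i f (delta_mx 0 i)).
Proof.
move=> lf u; have f0 : f 0 = 0.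
  by have /eqP := lf 1 0 0; rewrite scaler0 add0r mul1r -subr_eq subrr eq_sym => /eqP.
have fD : {morph f : u v / u + v} by move=> x y; have := lf 1 x y; rewrite scale1r mul1r.
rewrite {1}(row_sum_delta u) (big_morph f fD f0); apply: eq_bigr => i _.
by rewrite mxE -[_ *: _]addr0 lf f0 addr0.
Qed.

End DotProduct.

Section Farkas.
Variables (R : realType) (n : nat).

(** Induction on the number of generators. If the form separating [b] from the other generators is
    negative on the new one [q], everything is projected along [q] to the kernel of that form and
    the induction hypothesis is used once more. *)
Lemma farkas m (p : 'I_m -> 'rV[R]_n) (b : 'rV[R]_n) :
  (exists2 a : 'I_m -> R, forall i, 0 <= a i & b = \sum_i a i *: p i) \/
  (exists2 u, forall i, 0 <= dotp u (p i) & dotp u b < 0).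
Proof.
elim: m p b => [|m IH] p b.
  case: (eqVneq b 0) => [->|b0].
    by left; exists (fun=> 0) => //; rewrite big_ord0.
  by right; exists (- b) => [[]//|]; rewrite dotpNl oppr_lt0 dotp_gt0.
pose q := p ord0; pose p1 i := p (lift ord0 i).
have [[a a0 ->]|[u u0 ub]] := IH p1 b.
  left; exists (fun i => if unlift ord0 i is Some j then a j else 0).
    by move=> i; case: unliftP => [j _|_]; [exact: a0 | exact: lexx].
  rewrite big_ord_recl unlift_none scale0r add0r.
  by apply: eq_bigr => i _; rewrite liftK.
have [uq|uq] := leP 0 (dotp u q).
  by right; exists u => // i; case: (unliftP ord0 i) => [j|] ->; [exact: u0|].
(* The projection along [q] onto the kernel of [u], scaled by the positive number [- dotp u q]. *)
pose P v := (- dotp u q) *: v + dotp u v *: q.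
have [[a a0 eb]|[v v0 vb]] := IH (fun i => P (p1 i)) (P b); last first.
  (* The adjoint of [P] applied to [v]: its product with [x] is [dotp v (P x)], and [P q]
     vanishes. *)
  right; exists ((- dotp u q) *: v + dotp v q *: u).
    move=> i; rewrite dotpDl !dotpZl; case: (unliftP ord0 i) => [j|] ->.
      by have := v0 j; rewrite /P dotpDr !dotpZr mulrC [X in _ + X]mulrC.
    by rewrite -/q mulrC mulrN addrC mulrC subrr.
  by move: vb; rewrite /P dotpDr !dotpZr dotpDl !dotpZl [X in _ + X]mulrC.
left; have uq0 : 0 < - dotp u q by rewrite oppr_gt0.
(* The coefficient of [q] obtained by solving [eb] for [b]. *)
pose c := (\sum_i a i * dotp u (p1 i) - dotp u b) / - dotp u q.
exists (fun i => if unlift ord0 i is Some j then a j else c).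
  move=> i; case: unliftP => [j _|_]; first exact: a0.
  apply: divr_ge0; last exact: ltW.
  rewrite subr_ge0 (le_trans (ltW ub)) // sumr_ge0 // => j _.
  by rewrite mulr_ge0.
rewrite big_ord_recl unlift_none -/q.
under eq_bigr do rewrite liftK.
apply: (scalerI (lt0r_neq0 uq0)).
rewrite scalerDr scalerA /c [_ * (_ / _)]mulrC divfK ?lt0r_neq0 //.
have -> : (- dotp u q) *: b = P b - dotp u b *: q by rewrite addrK.
rewrite eb scalerBl.
rewrite [RHS]addrC addrA; congr (_ - _).
rewrite scaler_sumr scaler_suml -big_split; apply: eq_bigr => i _.
by rewrite /P scalerDr !scalerA mulrC.
Qed.
End Farkas.

(** * Minimal faces of a convex hull *)

Lemma lt_perturb (R : realType) (a b : R) : 0 < a ->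
  exists2 d, 0 < d & forall t, 0 < t <= d -> 0 < a + t * b.
Proof.
move=> a0; have nb : 0 < 1 + `|b| by apply: ltr_wpDr.
exists (a / (1 + `|b|)); first exact: divr_gt0.
move=> t /andP[t0]; rewrite (ler_pdivlMr _ _ nb) mulrDr mulr1 => td.
have : - (t * `|b|) <= t * b by rewrite -mulrN ler_pM2l // lerNl -normrN ler_norm.
by lra.
Qed.

Lemma small_all (R : realType) (T : finType) (C : T -> R -> Prop) :
  (forall j, exists2 d, 0 < d & forall t, 0 < t <= d -> C j t) ->
  exists2 d, 0 < d & forall t, 0 < t <= d -> forall j, C j t.
Proof.
move=> h; suff [d d0 H] : exists2 d, 0 < d & forall t, 0 < t <= d ->
    forall j, j \in enum T -> C j t.
  by exists d => // t td j; apply: H; rewrite ?mem_enum.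
elim: (enum T) => [|i r [d d0 IH]]; first by exists 1.
have [e e0 ce] := h i; exists (Num.min d e); first by rewrite lt_min d0.
move=> t /andP[t0]; rewrite le_min => /andP[td te] j.
by rewrite inE => /predU1P[->|]; [apply: ce; rewrite t0|apply: IH; rewrite t0].
Qed.

Section MinFaces.
Variables (R : realType) (n : nat).
Local Notation V := 'rV[R]_n.
Implicit Types (P Q F : set V) (u v w x y : V).

(** Faces are handled through minimizers, since the infimum [supp] is only informative once it is
    known to be attained. *)
Definition minface P w : set V :=
  [set x | P x /\ forall y, P y -> dotp w x <= dotp w y].

Lemma minface_eq P w x y : minface P w x -> minface P w y ->
  dotp w x = dotp w y.
Proof. by case=> px hx [py hy]; apply/le_anti; rewrite hx ?hy. Qed.

Lemma supp_minface P w x : minface P w x -> supp P w = dotp w x.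
Proof.
case=> px hx; apply/le_anti/andP; split.
  apply: ge_inf; last by exists x.
  by exists (dotp w x) => _ [y py <-]; apply: hx.
apply: lb_le_inf => [|_ [y py <-]]; last exact: hx.
by exists (dotp w x); exists x.
Qed.

Lemma minface_supp P w x y : minface P w y -> P x -> dotp w x = supp P w ->
  minface P w x.
Proof.
by move=> hy px e; split=> // z pz; rewrite e (supp_minface hy); apply: hy.2.
Qed.

Lemma supp_le P w y x : minface P w y -> P x -> supp P w <= dotp w x.
Proof. by move=> h; rewrite (supp_minface h); apply: h.2. Qed.

Lemma face_minface P F : face P F -> exists w, F = minface P w.
Proof.
case=> -[x0 Fx0] [w [c [hc eF]]]; exists w.
have [Px0 ec] : P x0 /\ dotp w x0 = c by rewrite eF in Fx0.
rewrite eF -ec; apply/seteqP; split=> x [Px e]; split=> //.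
  by move=> y Py; rewrite e ec; apply: hc.
by apply/le_anti; rewrite e // ec hc.
Qed.

Lemma minface_face P w : minface P w !=set0 -> face P (minface P w).
Proof.
move=> [x0 h0]; split; first by exists x0.
exists w, (dotp w x0); split; first exact: h0.2.
apply/seteqP; split=> x; first by move=> h; split; [exact: h.1|exact: minface_eq h h0].
by case=> px e; split=> // y py; rewrite e; apply: h0.2.
Qed.

(* [P] is an intersection of closed half-spaces. *)
Definition hconvex P : Prop :=
  forall x, (forall u, exists2 y, P y & dotp u y <= dotp u x) -> P x.

Lemma hconvex_segment P x y t : hconvex P -> P x -> P y -> 0 <= t <= 1 ->
  P (x + t *: (y - x)).
Proof.
move=> hP px py /andP[t0 t1]; apply: hP => u.
rewrite dotpDr dotpZr dotpBr.
by have [le|/ltW le] := leP (dotp u x) (dotp u y); [exists x|exists y] => //; nra.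
Qed.

Lemma hconvex_level P w c x y : hconvex P -> P x -> P y ->
  dotp w x <= c < dotp w y ->
  exists t, [/\ 0 <= t < 1, P (x + t *: (y - x)) & dotp w (x + t *: (y - x)) = c].
Proof.
move=> hP px py /andP[xc cy].
have d0 : 0 < dotp w y - dotp w x by rewrite subr_gt0 (le_lt_trans xc).
have [t0 t1] : 0 <= (c - dotp w x) / (dotp w y - dotp w x) /\
    (c - dotp w x) / (dotp w y - dotp w x) < 1.
  by rewrite ltr_pdivrMr // mul1r ltrD2r; split=> //; apply: divr_ge0;
     [rewrite subr_ge0|apply: ltW].
exists ((c - dotp w x) / (dotp w y - dotp w x)); split; first by rewrite t0.
  by apply: hconvex_segment; rewrite ?t0 ?ltW.
by rewrite dotpDr dotpZr dotpBr divfK ?lt0r_neq0 // addrC subrK.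
Qed.

Lemma dotp_row_mx m (u x : 'rV[R]_m) (v y : V) :
  dotp (row_mx u v) (row_mx x y) = dotp u x + dotp v y.
Proof.
rewrite /dotp big_split_ord; congr (_ + _); apply: eq_bigr => i _.
  by rewrite !row_mxEl.
by rewrite !row_mxEr.
Qed.

End MinFaces.

Section Hull.
Variables (R : realType) (n m : nat) (p : 'I_m.+1 -> 'rV[R]_n).
Implicit Types (u v w x y : 'rV[R]_n).

Lemma hull_gen i : hull p (p i).
Proof.
exists (fun j => (j == i)%:R); split.
- by move=> j; apply: ler0n.
- rewrite (bigD1 i) //= eqxx big1 => [|j /negPf ->] //; exact: addr0.
- rewrite (bigD1 i) //= eqxx scale1r big1 => [|j /negPf ->]; last exact: scale0r.
  by rewrite addr0.
Qed.

Lemma hull_ge u c x : (forall i, c <= dotp u (p i)) -> hull p x -> c <= dotp u x.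
Proof.
move=> h [a [a0 a1 ->]]; rewrite dotp_sumr -[c]mul1r -a1 mulr_suml.
by apply: ler_sum => i _; rewrite dotpZr ler_wpM2l.
Qed.

Lemma hull_argmin u : exists i, minface (hull p) u (p i).
Proof.
case: (@arg_minP _ _ _ ord0 xpredT (fun i => dotp u (p i))) => // i _ hi.
by exists i; split; [apply: hull_gen|move=> y; apply: hull_ge => j; apply: hi].
Qed.

Lemma minface_gen u i0 i : minface (hull p) u (p i0) ->
  dotp u (p i) <= dotp u (p i0) -> minface (hull p) u (p i).
Proof.
move=> h le; split=> [|y py]; first exact: hull_gen.
by apply: le_trans le _; apply: h.2.
Qed.

(** Farkas' lemma for the generators with an extra coordinate 1, which turns conic combinations into
    convex ones; the last coordinate of a separating form is the constant of an affine
    inequality. *)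
Lemma hull_hconvex : hconvex (hull p).
Proof.
move=> x hx; have := farkas (fun i => row_mx (p i) (1 : 'rV[R]_1)) (row_mx x 1).
case=> [[a a0 e]|[u u0 ux]]; last first.
  move: ux u0; rewrite -(hsubmxK u) dotp_row_mx => ux u0.
  have [y /hull_ge hy le] := hx (lsubmx u).
  have : - dotp (rsubmx u) 1 <= dotp (lsubmx u) y.
    by apply: hy => i; have := u0 i; rewrite dotp_row_mx; lra.
  by move: le ux; lra.
exists a; split=> //.
  have /(congr1 (fun M : 'rV__ => rsubmx M 0 0)) := e.
  rewrite row_mxKr linear_sum summxE [LHS]mxE eqxx => /esym e1; rewrite -[RHS]e1.
  by apply: eq_bigr => i _; rewrite linearZ /= row_mxKr !mxE mulr1.
have /(congr1 (fun M : 'rV__ => lsubmx M)) := e.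
rewrite row_mxKl linear_sum => ->.
by apply: eq_bigr => i _; rewrite linearZ /= row_mxKl.
Qed.

(** A point minimizing [u] puts weight only on generators minimizing [u], because its excess over
    the minimum is a sum of nonnegative terms. *)
Lemma minface_sub_gen u v :
  (forall i, minface (hull p) u (p i) -> minface (hull p) v (p i)) ->
  minface (hull p) u `<=` minface (hull p) v.
Proof.
move=> h x ux; have [i0 ui0] := hull_argmin u; have vi0 := h _ ui0.
have [a [a0 a1 ex]] := ux.1.
have key i : a i * dotp v (p i) = a i * dotp v (p i0).
  have s : \sum_i a i * (dotp u (p i) - dotp u (p i0)) = 0.
    transitivity (dotp u x - dotp u (p i0)); last by rewrite (minface_eq ux ui0) subrr.
    rewrite ex dotp_sumr -[in RHS](mul1r (dotp u (p i0))) -a1 mulr_suml -sumrB.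
    by apply: eq_bigr => j _; rewrite dotpZr mulrBr.
  have s0 j : true -> 0 <= a j * (dotp u (p j) - dotp u (p i0)).
    by move=> _; rewrite mulr_ge0 // subr_ge0; apply: ui0.2; apply: hull_gen.
  have /eqP := psumr_eq0P s0 s (i := i) isT.
  rewrite mulf_eq0 subr_eq0 => /orP[/eqP->|/eqP e]; first by rewrite !mul0r.
  by congr (_ * _); apply: minface_eq (h _ (minface_gen ui0 _)) vi0; rewrite e.
apply: (minface_supp vi0 ux.1); rewrite (supp_minface vi0) ex dotp_sumr.
under eq_bigr do rewrite dotpZr key.
by rewrite -mulr_suml a1 mul1r.
Qed.

(** There are finitely many generators, and each one that is not optimal for [u] keeps a positive
    gap under a small tilt. Such tilts are the means of selecting subfaces. *)
Lemma minface_perturb u v :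
  exists2 d, 0 < d & minface (hull p) (u + d *: v) `<=` minface (hull p) u.
Proof.
have [i0 hi0] := hull_argmin u.
have [j|d d0 H] := @small_all R 'I_m.+1 (fun j t => minface (hull p) (u + t *: v) (p j) ->
   minface (hull p) u (p j)).
  have [le|lt] := leP (dotp u (p j)) (dotp u (p i0)).
    by exists 1 => // t _ _; apply: minface_gen hi0 le.
  have [d d0 hd] := @lt_perturb R (dotp u (p j) - dotp u (p i0))
     (dotp v (p j) - dotp v (p i0)) ltac:(by rewrite subr_gt0).
  exists d => // t /hd h [_ /(_ _ (hull_gen i0))].
  by rewrite !dotpDl !dotpZl; move: h; lra.
by exists d => //; apply: minface_sub_gen => i; apply: H; rewrite d0 lexx.
Qed.

Lemma vertex_in_minface u : exists x v,
  [/\ minface (hull p) u x, minface (hull p) v = [set x] & vertex (hull p) x].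
Proof.
pose c v := #|[set i | `[< minface (hull p) v (p i) >]]%SET|.
have [k] := ubnP (c u); elim: k u => // k IH u; rewrite ltnS => cu.
have [i0 hi0] := hull_argmin u.
have [one|] := pselect (forall i, minface (hull p) u (p i) -> p i = p i0).
  exists (p i0), u; have e : minface (hull p) u = [set p i0].
    apply/seteqP; split=> [x ux|_ ->] //=; apply: dotp_inj => v.
    suff le w : dotp w (p i0) <= dotp w x.
      by apply/le_anti; rewrite le andbT; have := le (- v); rewrite !dotpNl lerN2.
    (* After a tilt towards any [w] the point [p i0] is still optimal, so [x] cannot be smaller
       along [w]; using [w] and [- w] gives equality. *)
    have [d d0 sub] := minface_perturb u w.
    have [j hj] := hull_argmin (u + d *: w); move: (hj); rewrite one; last exact: sub.
    case=> _ /(_ x ux.1); rewrite !dotpDl !dotpZl (minface_eq ux hi0) lerD2l.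
    by rewrite ler_pM2l.
  by split=> //; rewrite /vertex -e; apply: minface_face; exists (p i0).
move=> /existsNP[i /not_implyP[hi /eqP ne]].
(* Along their difference [p i] lies above [p i0], so this tilt removes at least [p i] from the
   optimal generators. *)
have [d d0 sub] := minface_perturb u (p i - p i0).
have [|x [v [ux hv vx]]] := IH (u + d *: (p i - p i0)).
  apply: leq_trans cu; apply: proper_card; apply/properP; split.
    by apply/fintype.subsetP => j; rewrite !inE; apply: sub.
  exists i; first by rewrite inE; apply/asboolP.
  rewrite inE; apply/asboolPn => -[_ /(_ _ (hull_gen i0))].
  rewrite !dotpDl !dotpZl (minface_eq hi hi0) lerD2l ler_pM2l // -subr_ge0 -dotpBr.
  by rewrite -oppr_le0 -dotpNr opprB leNgt dotp_gt0 // subr_eq0.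
by exists x, v; split=> //; apply: sub.
Qed.

End Hull.

(** * Polytopes realizing a simplicial complex *)

Section Lineality.
Variables (R : realType) (n : nat) (S : set 'rV[R]_n).

Lemma lineality0 : lineality S 0.
Proof. by move=> x y _ _; rewrite !dotp0l. Qed.

Lemma linealityD k l : lineality S k -> lineality S l -> lineality S (k + l).
Proof.
by move=> hk hl x y Sx Sy; rewrite !dotpDl (hk x y) ?(hl x y).
Qed.

Lemma linealityZ a l : lineality S l -> lineality S (a *: l).
Proof. by move=> hl x y Sx Sy; rewrite !dotpZl (hl x y). Qed.

End Lineality.

Section Realization.
Variables (R : realType) (n : nat) (I : finType) (S : set 'rV[R]_n).
Variable u : I -> 'rV[R]_n.
Implicit Types (P : set 'rV[R]_n) (D : set {set I}) (N : {set I}).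
Implicit Types (v w x y l : 'rV[R]_n) (a : I -> R).

Definition mface P N : set 'rV[R]_n :=
  [set x | P x /\ forall i, i \in N -> minface P (u i) x].

Definition ucone N : set 'rV[R]_n :=
  [set v | exists a l, [/\ forall i, 0 <= a i, forall i, 0 < a i -> i \in N,
                          lineality S l & v = \sum_i a i *: u i + l]].

(* [D] is an abstract simplicial complex on the indices of the vectors [u]; the
   axioms make the normal fan of [P] the set of cones [ucone N] for [N] in [D]
   (lemma [normal_fan_realizes]), with [mface P N] the face dual to [ucone N].
   An index [j] is a ray of the fan only if [D [set j]]. *)
Record realizes P D : Prop := Realizes {
  rz_hconvex : hconvex P;
  rz_sub : P `<=` S;
  rz_down : forall N N', D N -> N' \subset N -> D N';
  rz_mface : forall N, D N -> mface P N !=set0;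
  rz_complete : forall v, exists N a l, [/\ D N, forall i, 0 <= a i,
     forall i, (0 < a i) = (i \in N), lineality S l &
     v = \sum_i a i *: u i + l];
  rz_strict : forall N j, D N -> D [set j]%SET -> j \notin N ->
    exists2 x, mface P N x & ~ minface P (u j) x }.

Lemma mfaceS P N N' : N' \subset N -> mface P N `<=` mface P N'.
Proof. by move=> /fintype.subsetP s x [px h]; split=> // i /s; apply: h. Qed.

Lemma lineality_eq P l x y : P `<=` S -> lineality S l -> P x -> P y ->
  dotp l x = dotp l y.
Proof. by move=> s hl /s px /s; apply: hl. Qed.

Lemma ucone_mface P N v : P `<=` S -> ucone N v -> mface P N `<=` minface P v.
Proof.
move=> s [a [l [a0 aN hl ->]]] x [px h]; split=> // y py.
rewrite !dotpDl !dotp_suml (lineality_eq s hl px py) lerD2r.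
apply: ler_sum => i _; rewrite !dotpZl.
have := a0 i; rewrite le_eqVlt => /predU1P[<-|ai]; first by rewrite !mul0r.
by rewrite ler_pM2l //; apply: (h i (aN i ai)).2.
Qed.

(** Forms with a common minimizer have a sum minimized exactly at the common minimizers; positivity
    of all coefficients on [N] makes every index of [N] count. *)
Lemma mface_minface P N a l : P `<=` S -> (forall i, 0 <= a i) ->
    (forall i, (0 < a i) = (i \in N)) -> lineality S l -> mface P N !=set0 ->
  minface P (\sum_i a i *: u i + l) = mface P N.
Proof.
move=> s a0 aN hl [x0 hx0]; have [px0 m0] := hx0.
have vN : ucone N (\sum_i a i *: u i + l).
  by exists a, l; split=> // i; rewrite aN.
have m := ucone_mface s vN hx0.
apply/seteqP; split=> [x mx|]; last exact: ucone_mface.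
split=> [|i iN]; first by case: mx.
apply: (minface_supp (m0 i iN)); first by case: mx.
rewrite (supp_minface (m0 i iN)); apply/eqP; rewrite -subr_eq0 -dotpBr.
have := minface_eq mx m => /eqP; rewrite -subr_eq0 -dotpBr dotpDl dotp_suml.
rewrite [dotp l _]dotpBr (lineality_eq s hl mx.1 px0) subrr addr0 => /eqP z.
have z0 j : true -> 0 <= dotp (a j *: u j) (x - x0).
  move=> _; rewrite dotpZl; have := a0 j; rewrite le_eqVlt => /predU1P[<-|aj].
    by rewrite mul0r.
  by rewrite pmulr_rge0 // dotpBr subr_ge0; apply: (m0 j _).2 mx.1; rewrite -aN.
have /eqP := psumr_eq0P z0 z (i := i) isT.
by rewrite dotpZl mulf_eq0 gt_eqF // aN.
Qed.

Lemma sum_indicator N : \sum_(i in N) u i = \sum_i (i \in N)%:R *: u i + 0.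
Proof.
rewrite addr0 big_mkcond; apply: eq_bigr => i _.
by case: ifP; rewrite ?scale1r ?scale0r.
Qed.

Lemma mface_sum P N : P `<=` S -> mface P N !=set0 ->
  minface P (\sum_(i in N) u i) = mface P N.
Proof.
move=> s h; rewrite sum_indicator; apply: mface_minface => //.
- by move=> i; rewrite ltr0n lt0b.
- exact: lineality0.
Qed.

Section RealizationTheory.
Variables (P : set 'rV[R]_n) (D : set {set I}).
Hypothesis rz : realizes P D.

(** This is what [rz_strict] is for: simplices and faces determine each other, with inclusions
    reversed. *)
Lemma mface_subset N N' : D N -> D N' -> mface P N `<=` mface P N' -> N' \subset N.
Proof.
move=> dN dN' s; apply/fintype.subsetP => j jN'; apply: contraT => jN.
have dj : D [set j]%SET by apply: (rz_down rz) dN' _; rewrite finset.sub1set.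
have [x /s[_ h] []] := rz_strict rz dN dj jN; exact: h.
Qed.

Lemma minface_rep v : exists2 N, D N & ucone N v /\ minface P v = mface P N.
Proof.
have [N [a [l [dN a0 aN hl e]]]] := rz_complete rz v; exists N => //; split.
  by exists a, l; split=> // i; rewrite aN.
by rewrite e; apply: mface_minface (rz_sub rz) _ _ _ (rz_mface rz dN).
Qed.

Lemma minface_neq0 v : minface P v !=set0.
Proof. by have [N dN [_ ->]] := minface_rep v; apply: rz_mface rz _ dN. Qed.

Lemma uconeS N N' : N' \subset N -> ucone N' `<=` ucone N.
Proof.
move=> /fintype.subsetP s v [a [l [a0 aN hl e]]]; exists a, l; split=> // i.
by move/aN/s.
Qed.

Lemma ucone_minface N v : D N -> ucone N v <-> mface P N `<=` minface P v.
Proof.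
move=> dN; split; first exact: ucone_mface (rz_sub rz).
have [N' dN' [vN' ->]] := minface_rep v.
by move=> /(mface_subset dN dN') s; apply: uconeS s _ vN'.
Qed.

Lemma normal_cone_mface N : D N -> normal_cone P (mface P N) = ucone N.
Proof.
move=> dN; apply/seteqP; split=> v.
  move=> h; apply/(ucone_minface _ dN) => x hx.
  have [y hy] := minface_neq0 v.
  by apply: minface_supp hy _ (h x hx); case: hx.
by move=> /(ucone_minface _ dN) s x /s /supp_minface.
Qed.

Lemma normal_fan_realizes : normal_fan P = [set ucone N | N in D].
Proof.
apply/seteqP; split=> [_ [F /face_minface[w ->] <-]|_ [N dN <-]].
  by have [N dN [_ ->]] := minface_rep w; rewrite normal_cone_mface //; exists N.
exists (mface P N); last exact: normal_cone_mface.
have h := rz_mface rz dN.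
by rewrite -(mface_sum (rz_sub rz)) //; apply: minface_face; rewrite mface_sum //; apply: rz_sub rz.
Qed.

Lemma ucone_sum N : ucone N (\sum_(i in N) u i).
Proof.
exists (fun i => (i \in N)%:R), 0; split; [|  |exact: lineality0|exact: sum_indicator].
  by move=> i; rewrite ler0n.
by move=> i; rewrite ltr0n lt0b.
Qed.

Lemma ucone_subset N N' : D N -> D N' -> ucone N' `<=` ucone N <-> N' \subset N.
Proof.
move=> dN dN'; split; last exact: uconeS.
move=> /(_ _ (ucone_sum N')) /(ucone_minface _ dN).
rewrite mface_sum; first exact: mface_subset.
  exact: rz_sub rz.
exact: rz_mface rz _ dN'.
Qed.

(** One point on each face [mface P N] is enough: every linear form attains its minimum on such a
    face, so no form separates [P] from the hull of these points. *)
Lemma realizes_hull : exists m (p : 'I_m.+1 -> 'rV[R]_n), P = hull p.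
Proof.
have [N0 [_ [_ [dN0 _ _ _ _]]]] := rz_complete rz 0.
have d0 : D finset.set0 by apply: (rz_down rz) dN0 (finset.sub0set _).
have [x0 hx0] := rz_mface rz d0.
pose y N := xget x0 (mface P N).
have yP N : P (y N) by rewrite /y; case: xgetP => [z _ []|_] //; case: hx0.
pose m := #|{set I}|.-1.
have em : #|{set I}| = m.+1 by rewrite prednK //; apply/card_gt0P; exists finset.set0.
pose p (j : 'I_m.+1) := y (enum_val (cast_ord (esym em) j)).
have pE N : exists j, p j = y N.
  by exists (cast_ord em (enum_rank N)); rewrite /p cast_ordK enum_rankK.
exists m, p; apply/seteqP; split=> x; last first.
  move=> hx; apply: (rz_hconvex rz) => v; have [i [hi h]] := hull_argmin p v.
  by exists (p i); [apply: yP|apply: h].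
move=> Px; apply: hull_hconvex => v; have [N dN [_ e]] := minface_rep v.
have [j pj] := pE N; exists (p j); first exact: hull_gen.
have : minface P v (p j) by rewrite e pj; apply: (xgetPex x0 (rz_mface rz dN)).
by case=> _; apply.
Qed.

Lemma supp_linear_on N : D N -> exists x, forall v, ucone N v -> supp P v = dotp v x.
Proof.
move=> dN; have [x hx] := rz_mface rz dN; exists x => v.
by move=> /(ucone_mface (rz_sub rz)) /(_ x hx) /supp_minface.
Qed.

(** The cones contain the lineality space of [S], so values on the rays alone do not determine a
    piecewise linear function. *)
Lemma PL_eq (f g : 'rV[R]_n -> R) :
    PL [set ucone N | N in D] f -> PL [set ucone N | N in D] g ->
    (forall i, D [set i]%SET -> f (u i) = g (u i)) ->
  (forall l, lineality S l -> f l = g l) -> f = g.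
Proof.
move=> hf hg ei el; apply/funext => v.
have [N [a [l [dN a0 aN hl ->]]]] := rz_complete rz v.
have vN : ucone N (\sum_i a i *: u i + l) by exists a, l; split=> // i; rewrite aN.
have iN i : i \in N -> ucone N (u i).
  move=> iN; apply: (@uconeS N [set i]%SET); first by rewrite finset.sub1set.
  by have := ucone_sum [set i]; rewrite big_set1.
have lN : ucone N l.
  exists (fun=> 0), l; split=> //; first by move=> i; rewrite ltxx.
  by rewrite big1 ?add0r // => i _; rewrite scale0r.
have [x hx] : exists x, forall v, ucone N v -> f v = dotp v x.
  by apply: hf; exists N.
have [y hy] : exists y, forall v, ucone N v -> g v = dotp v y.
  by apply: hg; exists N.
rewrite hx // hy // !dotpDl !dotp_suml -hx // -hy // el //; congr (_ + _).
apply: eq_bigr => i _; rewrite !dotpZl.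
have := a0 i; rewrite le_eqVlt => /predU1P[<-|]; first by rewrite !mul0r.
rewrite aN => h; rewrite -(hx _ (iN i h)) -(hy _ (iN i h)) ei //.
by apply: (rz_down rz) dN _; rewrite finset.sub1set.
Qed.

End RealizationTheory.

End Realization.

(** * Shallowness in terms of faces *)

Section Direction.
Variables (R : realType) (n : nat).
Implicit Types (P Q : set 'rV[R]_n) (U W : {vspace 'rV[R]_n}).

(** The default of [xget] is never taken: a subspace of least dimension containing all differences
    is the least one, since intersecting it with another such subspace cannot lower its
    dimension. *)
Lemma direction_spec P :
  (forall x y, P x -> P y -> x - y \in direction P) /\
  (forall W, (forall x y, P x -> P y -> x - y \in W) -> (direction P <= W)%VS).
Proof.
pose C U := forall x y, P x -> P y -> x - y \in U.
apply: (@xgetPex _ 0%VS (fun U => C U /\ forall W, C W -> (U <= W)%VS)).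
have [|k /asboolP[U CU dU] min] := ex_minnP (P := fun k => `[< exists2 U, C U & \dim U = k >]).
  exists (\dim (fullv : {vspace 'rV[R]_n})); apply/asboolP.
  by exists fullv => // x y _ _; rewrite memvf.
exists U; split=> // W CW.
have CUW : C (U :&: W)%VS by move=> x y Px Py; rewrite memv_cap CU ?CW.
have le : (\dim U <= \dim (U :&: W))%N.
  by rewrite dU; apply: min; apply/asboolP; exists (U :&: W)%VS.
have /eqP e : ((U :&: W)%VS == U) by rewrite eqEdim capvSl.
by rewrite -e capvSr.
Qed.

Lemma direction_mem P x y : P x -> P y -> x - y \in direction P.
Proof. exact: (direction_spec P).1. Qed.

Lemma direction_le P W : (forall x y, P x -> P y -> x - y \in W) ->
  (direction P <= W)%VS.
Proof. exact: (direction_spec P).2. Qed.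

Lemma directionS P Q : P `<=` Q -> (direction P <= direction Q)%VS.
Proof. by move=> s; apply: direction_le => x y /s Qx /s; apply: direction_mem. Qed.

End Direction.

Section Shallow.
Variables (R : realType) (n : nat) (I : finType) (S : set 'rV[R]_n).
Variable u : I -> 'rV[R]_n.
Variables (P : set 'rV[R]_n) (D : set {set I}).
Hypothesis rz : realizes S u P D.
Implicit Types (N : {set I}) (v w x y l : 'rV[R]_n).

Definition in_span N v : Prop := exists (b : I -> R) l,
  [/\ forall i, i \notin N -> b i = 0, lineality S l & v = \sum_i b i *: u i + l].

Lemma vertex_mface y : vertex P y -> exists2 N, D N & mface u P N = [set y].
Proof.
by move=> /face_minface[w e]; have [N dN [_ e']] := minface_rep rz w; exists N; rewrite // e e'.
Qed.

Lemma vertex_span N y v : D N -> mface u P N = [set y] -> in_span N v.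
Proof.
move=> dN e; have [m [p eP]] := realizes_hull rz.
have Ny : mface u P N y by rewrite e.
have e0 : minface P (\sum_(i in N) u i) = [set y].
  by rewrite -e (mface_sum (rz_sub rz)) //; exists y.
have [d d0] := minface_perturb p (\sum_(i in N) u i) v; rewrite -eP e0 => s.
have [N2 dN2 [[a [l [a0 aN hl ea]]] e2]] := minface_rep rz (\sum_(i in N) u i + d *: v).
have N2N : N2 \subset N.
  apply: (mface_subset rz) => //; rewrite -e2 e => _ ->.
  have [x hx] := minface_neq0 rz (\sum_(i in N) u i + d *: v).
  by rewrite -(s _ hx).
exists (fun i => d^-1 * (a i - (i \in N)%:R)), (d^-1 *: l); split.
- move=> i iN; rewrite (negPf iN) subr0.
  have := a0 i; rewrite le_eqVlt => /predU1P[<-|/aN /(fintype.subsetP N2N)]; first by rewrite mulr0.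
  by rewrite (negPf iN).
- exact: linealityZ.
apply: (scalerI (lt0r_neq0 d0)); rewrite scalerDr scalerA divff ?lt0r_neq0 // scale1r.
apply: (addrI (\sum_(i in N) u i)); rewrite ea addrA; congr (_ + _).
rewrite [\sum_(i in N) _]sum_indicator addr0 scaler_sumr -big_split; apply: eq_bigr => i _.
by rewrite scalerA mulrA divff ?lt0r_neq0 // mul1r /= -scalerDl addrC subrK.
Qed.

(* The pivoting step of the simplex method: in the basis dual to the rays at [y],
   a negative coefficient of [v] gives an edge along which [v] decreases. *)
Lemma improving_edge v y : vertex P y -> ~ minface P v y ->
  exists2 y', vertex P y' /\ adjacent P y' y & dotp v y' < dotp v y.
Proof.
move=> vy nvy; have [N dN e] := vertex_mface vy.
have Ny : mface u P N y by rewrite e.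
have Psub := rz_sub rz.
have [b [l [bN hl ev]]] := vertex_span v dN e.
have [i [iN bi]] : exists i, i \in N /\ b i < 0.
  apply: contra_notP nvy => /forallNP h; apply: (ucone_mface Psub _ Ny).
  have b0 i : 0 <= b i.
    have [iN|/bN-> //] := boolP (i \in N); rewrite leNgt; apply/negP => bi.
    by apply: (h i).
  by exists b, l; split=> // i; apply: contraTT => /bN ->; rewrite ltxx.
(* Dropping [i] gives the edge at [y] that leaves the facet of [i]. *)
pose N1 := N :\ i.
have N1N : N1 \subset N by apply: subD1set.
have dN1 : D N1 by apply: rz_down rz _ _ dN N1N.
have di : D [set i]%SET by apply: rz_down rz _ _ dN _; rewrite finset.sub1set.
have [z0 hz0 nz0] : exists2 x, mface u P N1 x & ~ minface P (u i) x.
  by apply: rz_strict rz _ _ dN1 di _; rewrite !inE eqxx.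
have N1y : mface u P N1 y by apply: mfaceS N1N _ Ny.
have key v' b' l' z : (forall j, j \notin N -> b' j = 0) -> lineality S l' ->
    v' = \sum_j b' j *: u j + l' -> mface u P N1 z ->
    dotp v' (z - y) = b' i * dotp (u i) (z - y).
  move=> b'N hl' -> hz; rewrite dotpDl dotp_suml.
  rewrite [dotp l' _]dotpBr (lineality_eq Psub hl' hz.1 Ny.1) subrr addr0.
  rewrite (bigD1 i) //= dotpZl big1 ?addr0 // => j ji; rewrite dotpZl.
  have [jN|/b'N->] := boolP (j \in N); last by rewrite mul0r.
  have jN1 : j \in N1 by rewrite !inE ji.
  by rewrite dotpBr (minface_eq (hz.2 j jN1) (N1y.2 j jN1)) subrr mulr0.
have uiy : minface P (u i) y by apply: Ny.2.
have s0 : 0 < dotp (u i) (z0 - y).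
  rewrite dotpBr subr_gt0 lt_def (uiy.2 _ hz0.1) andbT; apply/eqP => ez.
  by apply: nz0; apply: (minface_supp uiy hz0.1); rewrite (supp_minface uiy).
have line z : mface u P N1 z ->
    z - y = (dotp (u i) (z - y) / dotp (u i) (z0 - y)) *: (z0 - y).
  move=> hz; apply: dotp_inj => v'; have [b' [l' [b'N hl' ev']]] := vertex_span v' dN e.
  rewrite dotpZr (key v' b' l' z) // (key v' b' l' z0) //.
  by rewrite mulrA mulrAC mulrC divfK ?lt0r_neq0.
have eE : minface P (\sum_(j in N1) u j) = mface u P N1.
  by apply: (mface_sum Psub); exists y.
have dimE : adim (mface u P N1) = 1%N.
  have -> : adim (mface u P N1) = \dim <[z0 - y]>%VS.
    congr (\dim _); apply/eqP; rewrite eqEsubv; apply/andP; split.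
      apply: direction_le => x1 x2 /line h1 /line h2.
      have -> : x1 - x2 = (x1 - y) - (x2 - y) by rewrite opprB addrA subrK.
      by rewrite h1 h2; apply: rpredB; apply: memvZ (memv_line _).
    by rewrite -memvE; apply: direction_mem.
  rewrite dim_vline; have -> // : z0 - y != 0.
  by apply: contraTneq s0 => ->; rewrite dotp0r ltxx.
have [m [p eP]] := realizes_hull rz.
(* The other end of the edge is a vertex on which [u i] is largest. *)
have [d d0] := minface_perturb p (\sum_(j in N1) u j) (- u i); rewrite -eP eE => s.
have [y' [w [hy' _ vy']]] := vertex_in_minface p (\sum_(j in N1) u j + d *: - u i).
rewrite -eP in hy' vy'; have Ey' := s _ hy'.
have lt : dotp (u i) y < dotp (u i) y'.
  move: s0; rewrite dotpBr subr_gt0 => /lt_le_trans; apply.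
  have := hy'.2 z0 hz0.1; rewrite !dotpDl !dotpZl !dotpNl.
  rewrite (@minface_eq _ _ P _ y' z0) ?eE // lerD2l ler_pM2l // lerN2.
  by [].
have ltv : dotp v y' < dotp v y.
  rewrite -subr_lt0 -dotpBr (key v b l y') //.
  by rewrite nmulr_rlt0 // dotpBr subr_gt0.
exists y' => //; split=> //; split.
  by move=> e1; rewrite e1 ltxx in ltv.
exists (mface u P N1); split=> //.
by rewrite -eE; apply: minface_face; rewrite eE; exists y.
Qed.

(** Shallowness in the form that the truncation step uses: every face not contained in the face
    being cut off reaches strictly beyond the cut. *)
Definition roomy eps (K : {set I}) w : Prop := 0 < eps /\
  forall N, D N -> ~~ (K \subset N) ->
    exists2 y, mface u P N y & supp P w + eps < dotp w y.

(* Only neighbours of the face enter the definition of shallow; a vertex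
   off the face minimizing [w] is such a neighbour by [improving_edge]. *)
Lemma shallowP eps K : D K ->
  shallow eps P (mface u P K) (\sum_(i in K) u i) <->
  roomy eps K (\sum_(i in K) u i).
Proof.
move=> dK; set w := \sum_(i in K) u i; have Psub := rz_sub rz.
have ew : minface P w = mface u P K by apply: (mface_sum Psub); apply: rz_mface rz _ dK.
split=> -[e0 h]; split=> //; last first.
  move=> x y _ _ vy Ky _.
  have [N dN e] := vertex_mface vy; rewrite ltrBrDl.
  have Ny : mface u P N y by rewrite e.
  have KN : ~~ (K \subset N) by apply/negP => s; apply/Ky/(mfaceS s).
  by have [y' ] := h N dN KN; rewrite e => ->.
move=> N dN KN; have far y : vertex P y -> ~ mface u P K y -> supp P w + eps < dotp w y.
  (* Vertices off the face are enumerated by their simplices, so one with least [w] exists. An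
     improving edge from it can only end on the face being cut off, which makes the hypothesis on
     neighbours applicable. *)
  pose good A := `[< D A /\ exists2 y, mface u P A = [set y] & ~ mface u P K y >].
  pose val A := dotp w (xget 0 (mface u P A)).
  have valE A z : mface u P A = [set z] -> val A = dotp w z.
    by rewrite /val => ->; rewrite (@xget_unique _ _ _ z).
  move=> vy Ky; have [N0 dN0 e0'] := vertex_mface vy.
  have g0 : good N0 by apply/asboolP; split=> //; exists y.
  case: (@arg_minP _ _ _ N0 good val g0) => N1 /asboolP[dN' [y1 e1 Ky1]] min.
  have := min _ g0; rewrite (valE _ _ e1) (valE _ _ e0'); apply: lt_le_trans.
  have vy1 : vertex P y1.
    rewrite /vertex -e1 -(mface_sum Psub); last by rewrite e1; exists y1.
    by apply: minface_face; rewrite (mface_sum Psub) // e1; exists y1.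
  have [|y2 [vy2 adj] lt] := improving_edge (v := w) vy1; first by rewrite ew.
  have [Ky2|Ky2] := pselect (mface u P K y2).
    by rewrite -ltrBrDl; apply: h adj.
  have [N2 dN2 e2] := vertex_mface vy2.
  have : val N1 <= val N2 by apply: min; apply/asboolP; split=> //; exists y2.
  by rewrite (valE _ _ e1) (valE _ _ e2) leNgt lt.
have [m [p eP]] := realizes_hull rz.
have eN : minface P (\sum_(i in N) u i) = mface u P N.
  by apply: (mface_sum Psub); apply: rz_mface rz _ dN.
(* A vertex of the face of [N] with [w] as large as possible. Were it on the face of [K], then [w]
   would be minimal on the whole face of [N], forcing [K] into [N]. *)
have [d d0] := minface_perturb p (\sum_(i in N) u i) (- w); rewrite -eP eN => s.
have [y [v [hy _ vy]]] := vertex_in_minface p (\sum_(i in N) u i + d *: - w).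
rewrite -eP in hy vy; have Ny := s _ hy; exists y => //; apply: far => // Ky.
move/negP: KN; apply; apply: (mface_subset rz) => // x Nx; rewrite -ew in Ky *.
apply: (minface_supp Ky Nx.1); rewrite (supp_minface Ky).
apply/le_anti; rewrite (Ky.2 _ Nx.1) andbT.
have := hy.2 x Nx.1; rewrite !dotpDl !dotpZl !dotpNl.
by rewrite (@minface_eq _ _ P _ y x) ?eN // lerD2l ler_pM2l // lerN2.
Qed.

End Shallow.

(** * Stellar subdivision by truncation *)

Section StellarStep.
Variables (R : realType) (n : nat) (I : finType) (S : set 'rV[R]_n).
Variable u : I -> 'rV[R]_n.
Implicit Types (P : set 'rV[R]_n) (D : set {set I}) (N K : {set I}).
Implicit Types (v w x y l : 'rV[R]_n).

(** Here [k] indexes the new ray, and [D (N :\ k :|: K)] says that [N :\ k] spans a face of some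
    cone containing the cone of [K]. For [K = [set k]] the result is [D] again, so cutting a facet
    is not a separate case. *)
Definition stellar_complex (k : I) K D : set {set I} :=
  [set N : {set I} | if k \in N then ~~ (K \subset N :\ k) /\ D (N :\ k :|: K)
           else D N /\ ~~ (K \subset N)].

Lemma minface_segment P v x y t : 0 <= t <= 1 -> P x -> P y ->
    minface P v (x + t *: (y - x)) ->
  (t < 1 -> minface P v x) /\ (0 < t -> minface P v y).
Proof.
move=> /andP[t0 t1] px py hz.
have := hz.2 x px; have := hz.2 y py; rewrite dotpDr dotpZr dotpBr => hy hx.
split=> ht; apply: (minface_supp hz) => //; rewrite (supp_minface hz);
  rewrite dotpDr dotpZr dotpBr.
  have : (1 - t) * (dotp v y - dotp v x) >= 0 by lra.
  rewrite pmulr_rge0 ?subr_gt0 // => h.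
  have : t * (dotp v y - dotp v x) <= 0 by lra.
  have : 0 <= t * (dotp v y - dotp v x) by rewrite mulr_ge0.
  lra.
have : t * (dotp v y - dotp v x) <= 0 by lra.
rewrite pmulr_rle0 // => h.
have : (1 - t) * (dotp v y - dotp v x) >= 0 by lra.
have : (1 - t) * (dotp v y - dotp v x) <= 0.
  by apply: mulr_ge0_le0 => //; rewrite subr_ge0.
lra.
Qed.

Lemma mface_level P N w c x y : hconvex P -> mface u P N x -> mface u P N y ->
    dotp w x <= c < dotp w y ->
  exists t, [/\ 0 <= t < 1, mface u P N (x + t *: (y - x)) &
                dotp w (x + t *: (y - x)) = c].
Proof.
move=> hP hx hy h; have [t [t01 pz ez]] := hconvex_level hP hx.1 hy.1 h.
exists t; split=> //; split=> // i iN.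
apply: (minface_supp (hx.2 i iN) pz).
rewrite (supp_minface (hx.2 i iN)) dotpDr dotpZr dotpBr.
by rewrite (minface_eq (hy.2 i iN) (hx.2 i iN)) subrr mulr0 addr0.
Qed.

Lemma ucone0 N : ucone S u N 0.
Proof.
exists (fun=> 0), 0; split=> // [i||]; first by rewrite ltxx.
  exact: lineality0.
by rewrite addr0 big1 // => i _; rewrite scale0r.
Qed.

Lemma ucone_ray N i : i \in N -> ucone S u N (u i).
Proof.
move=> iN; apply: (@uconeS _ _ _ _ _ N [set i]%SET); first by rewrite finset.sub1set.
by have := ucone_sum S u [set i]; rewrite big_set1.
Qed.

Lemma ucone_lineality N l : lineality S l -> ucone S u N l.
Proof.
move=> hl; exists (fun=> 0), l; split=> //; first by move=> i; rewrite ltxx.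
by rewrite big1 ?add0r // => i _; rewrite scale0r.
Qed.

Lemma uconeZ N a v : 0 <= a -> ucone S u N v -> ucone S u N (a *: v).
Proof.
move=> a0 [b [l [b0 bN hl ->]]]; exists (fun i => a * b i), (a *: l); split.
- by move=> i; rewrite mulr_ge0.
- move=> i; have := b0 i; rewrite le_eqVlt => /predU1P[<-|/bN //].
  by rewrite mulr0 ltxx.
- exact: linealityZ.
by rewrite scalerDr scaler_sumr; congr (_ + _); apply: eq_bigr => i _; rewrite scalerA.
Qed.

Lemma ucone_face N x : (forall l, lineality S l -> dotp x l = 0) ->
    (forall i, i \in N -> 0 <= dotp x (u i)) ->
  [set v | ucone S u N v /\ dotp x v = 0] =
  ucone S u [set i in N | dotp x (u i) == 0]%SET.
Proof.
move=> xl xN; apply/seteqP; split=> v.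
  move=> [[a [l [a0 aN hl ->]]]]; rewrite dotpDr dotp_sumr (xl l hl) addr0 => z.
  exists a, l; split=> // i ai; rewrite inE aN //=.
  have z0 j : true -> 0 <= dotp x (a j *: u j).
    move=> _; rewrite dotpZr; have := a0 j; rewrite le_eqVlt => /predU1P[<-|aj].
      by rewrite mul0r.
    by rewrite mulr_ge0 // xN // aN.
  have /eqP := psumr_eq0P z0 z (i := i) isT.
  by rewrite dotpZr mulf_eq0 gt_eqF.
move=> vN; split; first by apply: uconeS vN; apply/fintype.subsetP => i; rewrite inE => /andP[].
case: vN => a [l [a0 aN hl ->]]; rewrite dotpDr dotp_sumr (xl l hl) addr0.
apply: big1 => i _; rewrite dotpZr.
have := a0 i; rewrite le_eqVlt => /predU1P[<-|/aN]; first by rewrite mul0r.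
by rewrite inE => /andP[_ /eqP ->]; rewrite mulr0.
Qed.

Lemma face_ucone N t : face (ucone S u N) t ->
  exists2 N' : {set I}, N' \subset N & t = ucone S u N'.
Proof.
move=> ft; have [v0 tv0] := ft.1; have [x ex] := face_minface ft.
rewrite ex in tv0; have [hv0 min] := tv0.
(* A minimum over a cone must be 0: compare [v0] with its double and with the apex. *)
have e0 : dotp x v0 = 0.
  have := min _ (ucone0 N); have := min _ (uconeZ (ler0n R 2) hv0).
  by rewrite dotpZr dotp0r; lra.
have xge v : ucone S u N v -> 0 <= dotp x v by move=> /min; rewrite e0.
exists [set i in N | dotp x (u i) == 0]%SET.
  by apply/fintype.subsetP => i; rewrite inE => /andP[].
rewrite -ucone_face; first last.
- by move=> i iN; apply/xge/ucone_ray.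
- move=> l hl; apply/le_anti; rewrite (xge _ (ucone_lineality _ hl)) andbT.
  have := xge _ (ucone_lineality N (linealityZ (-1) hl)).
  by rewrite dotpZr mulN1r oppr_ge0.
rewrite ex; apply/seteqP; split=> v.
  by move=> h; split; [exact: h.1|rewrite (minface_eq h tv0)].
by move=> [h e]; split=> // y /xge; rewrite e.
Qed.

Lemma cone_add_ucone k N : k \notin N ->
  cone_add (u k) (ucone S u N) = ucone S u (k |: N).
Proof.
move=> kN; apply/seteqP; split=> v.
  move=> [a [_ [a0 [b [l [b0 bN hl ->]]] ->]]].
  exists (fun i => a * (i == k)%:R + b i), l; split=> //.
  - by move=> i; rewrite addr_ge0 // mulr_ge0.
  - move=> i; rewrite !inE; case: eqP => //= _; rewrite mulr0 add0r; exact: bN.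
  rewrite addrA; congr (_ + _).
  under [RHS]eq_bigr do rewrite scalerDl.
  rewrite big_split /=; congr (_ + _).
  rewrite (bigD1 k) //= eqxx mulr1 big1 ?addr0 // => i /negPf ->.
  by rewrite mulr0 scale0r.
move=> [a [l [a0 aN hl ->]]]; exists (a k), (\sum_(i | i != k) a i *: u i + l).
split=> //; last by rewrite (bigD1 k) //= addrA.
exists (fun i => if i == k then 0 else a i), l; split=> //.
- by move=> i; case: eqP.
- by move=> i; case: eqP => [_|/eqP ik /aN]; rewrite ?ltxx // !inE (negPf ik).
rewrite [in RHS](bigD1 k) //= eqxx scale0r add0r; congr (_ + _).
by apply: eq_bigr => i /negPf ->.
Qed.

Section Step.
Variables (P : set 'rV[R]_n) (D : set {set I}) (k : I) (K : {set I}).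
Hypotheses (rz : realizes S u P D) (DK : D K) (K0 : K != finset.set0).
Hypothesis uk : u k = \sum_(i in K) u i.
Hypothesis kK : K = [set k]%SET \/ ~ D [set k]%SET.

Let Psub := rz_sub rz.

Lemma stellar_index_notin N : D N -> ~~ (K \subset N) -> k \notin N.
Proof.
move=> dN KN; apply/negP => kN; have dk : D [set k]%SET.
  by apply: rz_down rz _ _ dN _; rewrite finset.sub1set.
by case: kK => // eK; rewrite eK finset.sub1set kN in KN.
Qed.

Lemma stellar_complexP1 N : D N -> ~~ (K \subset N) -> stellar_complex k K D N.
Proof.
by move=> dN KN; rewrite /stellar_complex /= (negPf (stellar_index_notin dN KN)).
Qed.

Lemma stellar_complexP2 N : D (N :|: K) -> ~~ (K \subset N) ->
  stellar_complex k K D (k |: N).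
Proof.
move=> dN KN; rewrite /stellar_complex /= setU11 finset.setU1K //.
by apply: stellar_index_notin KN; apply: rz_down rz _ _ dN (finset.subsetUl _ _).
Qed.

Lemma stellar_complexW N : stellar_complex k K D N -> k \in N ->
  [/\ D (N :\ k), ~~ (K \subset N :\ k) & D (N :\ k :|: K)].
Proof.
rewrite /stellar_complex /= => h kN; rewrite kN in h; case: h => h1 h2; split=> //.
by apply: rz_down rz _ _ h2 (finset.subsetUl _ _).
Qed.

Lemma stellar_complexN N : stellar_complex k K D N -> k \notin N ->
  D N /\ ~~ (K \subset N).
Proof. by rewrite /stellar_complex /= => h /negPf kN; rewrite kN in h. Qed.

(** Inclusions of cones reduce to inclusions of index sets. The point needing geometry is that the
    cone of [N :\ k] is an exposed face of the cone of [N :\ k :|: K]. *)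
Lemma stellar_ucone :
  stellar [set ucone S u N | N in D] (ucone S u K) (u k) =
  [set ucone S u N | N in stellar_complex k K D].
Proof.
apply/seteqP; split=> t.
  case=> [[[N dN <-] h]|[t' [h [_ [[N dN <-] s /face_ucone[N' N'N et]]]] <-]].
    exists N => //; apply: stellar_complexP1 => //.
    by apply/negP => /(ucone_subset rz dN DK).
  have KN := (ucone_subset rz dN DK).1 s.
  have dN' : D N' by apply: rz_down rz _ _ dN N'N.
  have KN' : ~~ (K \subset N').
    by apply/negP => /(ucone_subset rz dN' DK); rewrite -et.
  exists (k |: N').
    apply: stellar_complexP2 => //; apply: rz_down rz _ _ dN _.
    by rewrite finset.subUset N'N.
  by rewrite et cone_add_ucone // (stellar_index_notin dN').
move=> [N sN <-]; have [kN|kN] := boolP (k \in N); last first.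
  have [dN KN] := stellar_complexN sN kN; left; split; first by exists N.
  by move/(ucone_subset rz dN DK); apply/negP.
have [dN KN dNK] := stellar_complexW sN kN; right; exists (ucone S u (N :\ k)); last first.
  by rewrite cone_add_ucone ?finset.setD1K // !inE eqxx.
split; first by move/(ucone_subset rz dN DK); apply/negP.
exists (ucone S u (N :\ k :|: K)); split; first by exists (N :\ k :|: K).
  by apply/(ucone_subset rz dNK DK)/finset.subsetUr.
pose N' := N :\ k; pose N2 := N' :|: K.
have [y hy] := rz_mface rz dNK.
have hy' : mface u P N' y by apply: mfaceS (finset.subsetUl _ _) _ hy.
have hz i : exists z, mface u P N' z /\ (i \in N2 -> i \notin N' -> ~ minface P (u i) z).
  have [iN'|iN'] := boolP (i \in N'); first by exists y.
  have [iN2|iN2] := boolP (i \in N2); last by exists y.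
  have di : D [set i]%SET by apply: rz_down rz _ _ dNK _; rewrite finset.sub1set.
  by have [z h1 h2] := rz_strict rz dN di iN'; exists z.
have [z zP] := choice hz.
(* Each [z i - y] is nonnegative on the rays of [N2], zero on those of [N'], and positive on [u i]
   if [i] is not in [N']; their sum therefore exposes exactly [N']. *)
pose x := \sum_(i in N2) (z i - y).
have zge i j : j \in N2 -> 0 <= dotp (u j) (z i - y).
  move=> jN; rewrite dotpBr subr_ge0; apply: (hy.2 j jN).2; exact: (zP i).1.1.
have xl l : lineality S l -> dotp x l = 0.
  move=> hl; rewrite dotp_suml big1 // => i _; rewrite dotpC dotpBr.
  by rewrite (lineality_eq Psub hl (zP i).1.1 hy.1) subrr.
have xge i : i \in N2 -> 0 <= dotp x (u i).
  move=> iN; rewrite dotp_suml sumr_ge0 // => j _; rewrite dotpC; exact: zge.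
have eN' : [set i in N2 | dotp x (u i) == 0]%SET = N'.
  apply/setP => i; rewrite inE; apply/andP/idP => [[iN2]|iN'].
    apply: contraLR => iN'; rewrite gt_eqF // dotp_suml (bigD1 i) //=.
    apply: ltr_wpDr; first by apply: sumr_ge0 => j _; rewrite dotpC; apply: zge.
    rewrite dotpC lt_def zge // andbT dotpBr subr_eq0; apply/eqP => e.
    apply: ((zP i).2 iN2 iN'); apply: minface_supp (hy.2 i iN2) (zP i).1.1 _.
    by rewrite e (supp_minface (hy.2 i iN2)).
  have iN2 : i \in N2 by rewrite inE iN'.
  split=> //; rewrite dotp_suml big1 // => j _.
  by rewrite dotpC dotpBr (minface_eq ((zP j).1.2 i iN') (hy'.2 i iN')) subrr.
split; first by exists 0; apply: ucone0.
exists x, 0; split; last by rewrite ucone_face // eN'.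
move=> v [a [l [a0 aN hl ->]]]; rewrite dotpDr dotp_sumr xl // addr0.
apply: sumr_ge0 => i _; rewrite dotpZr; have := a0 i; rewrite le_eqVlt.
move=> /predU1P[<-|/aN iN]; first by rewrite mul0r.
by rewrite mulr_ge0 // xge.
Qed.

Lemma exists_roomy : exists eps, roomy u P D eps K (u k).
Proof.
have eK : minface P (u k) = mface u P K by rewrite uk (mface_sum Psub) //; apply: rz_mface rz _ DK.
have [|d d0 H] := @small_all R {set I} (fun N eps => D N -> ~~ (K \subset N) ->
    exists2 y, mface u P N y & supp P (u k) + eps < dotp (u k) y).
  move=> N; have [[dN KN]|h] := pselect (D N /\ ~~ (K \subset N)); last first.
    by exists 1 => // t _ dN KN; case: h.
  have [x0 hx0] := minface_neq0 rz (u k).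
  have [y Ny ny] : exists2 y, mface u P N y & ~ minface P (u k) y.
    apply: contrapT => h; move/negP: KN; apply; apply: (mface_subset rz) => // y Ny.
    by rewrite -eK; apply: contrapT => ny; apply: h; exists y.
  have lt : supp P (u k) < dotp (u k) y.
    rewrite lt_def (supp_le hx0 Ny.1) andbT; apply/eqP => e; apply: ny.
    exact: minface_supp hx0 Ny.1 e.
  exists ((dotp (u k) y - supp P (u k)) / 2); first by rewrite divr_gt0 ?subr_gt0.
  by move=> t /andP[t0 t1] _ _; exists y => //; lra.
by exists d; split=> // N; apply: H; rewrite d0 lexx.
Qed.

Variable eps : R.
Hypothesis rm : roomy u P D eps K (u k).
Let Q := truncation eps P (u k).
Let c := supp P (u k) + eps.

Let far N : D N -> ~~ (K \subset N) -> exists2 y, mface u P N y & c < dotp (u k) y.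
Proof. exact: rm.2. Qed.

Let QP x : Q x -> P x. Proof. by case. Qed.

Let eK : minface P (u k) = mface u P K.
Proof. by rewrite uk (mface_sum Psub) //; apply: rz_mface rz _ DK. Qed.

Let low x : mface u P K x -> dotp (u k) x < c.
Proof. by rewrite -eK => h; rewrite -(supp_minface h) /c ltrDl; case: rm. Qed.

Let minface_trunc v x : Q x -> minface P v x -> minface Q v x.
Proof. by move=> Qx [_ h]; split=> // y /QP; apply: h. Qed.

(** A segment inside the face of [N :\ k], from a point of the face of [K] to a point beyond the
    cut, meets the cutting hyperplane. *)
Let level N : stellar_complex k K D N -> k \in N ->
  exists z, [/\ Q z, mface u P (N :\ k) z & dotp (u k) z = c].
Proof.
move=> sN kN; have [dN KN dNK] := stellar_complexW sN kN.
have [y Ny ylt] := far dN KN; have [x hx] := rz_mface rz dNK.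
have xc : dotp (u k) x < c by apply: low; apply: mfaceS (finset.subsetUr _ _) _ hx.
have hx' : mface u P (N :\ k) x by apply: mfaceS (finset.subsetUl _ _) _ hx.
have [|t [_ hz ez]] := mface_level (rz_hconvex rz) hx' Ny (w := u k) (c := c).
  by rewrite ltW.
by exists (x + t *: (y - x)); split=> //; split; [exact: hz.1|rewrite ez].
Qed.

Lemma stellar_complex_set1 : stellar_complex k K D [set k]%SET.
Proof.
rewrite /stellar_complex /= inE eqxx finset.setDv finset.set0U finset.subset0 K0.
by split.
Qed.

Lemma level_minface z : Q z -> dotp (u k) z = c -> minface Q (u k) z.
Proof. by move=> Qz e; split=> // y [_]; rewrite e. Qed.

Lemma supp_truncation : supp Q (u k) = supp P (u k) + eps.
Proof.
have [|z [Qz _ ez]] := level stellar_complex_set1; first by rewrite inE.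
by rewrite (supp_minface (level_minface Qz ez)).
Qed.

Let other j : j != k -> stellar_complex k K D [set j]%SET ->
  exists y, [/\ D [set j]%SET, Q y & minface P (u j) y].
Proof.
move=> jk sj; have [|dj Kj] := stellar_complexN sj; first by rewrite inE eq_sym.
have [y [py hy] lt] := far dj Kj; exists y; split=> //; first by split=> //; apply: ltW.
by apply: hy; rewrite inE.
Qed.

Lemma supp_truncation_other j : j != k -> stellar_complex k K D [set j]%SET ->
  supp Q (u j) = supp P (u j).
Proof.
move=> jk sj; have [y [dj Qy hy]] := other jk sj.
by rewrite (supp_minface hy) (supp_minface (minface_trunc Qy hy)).
Qed.

Lemma realizes_truncation : realizes S u Q (stellar_complex k K D).
Proof.
split.
- move=> x hx; split.
    by apply: (rz_hconvex rz) => v; have [y /QP] := hx v; exists y.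
  by have [y [_ h] le] := hx (u k); apply: le_trans le.
- by move=> x /QP /Psub.
- move=> N N' sN N'N; have [kN|kN] := boolP (k \in N).
    have [dN KN dNK] := stellar_complexW sN kN.
    have [kN'|kN'] := boolP (k \in N').
      rewrite /stellar_complex /= kN'; have s := finset.setSD [set k] N'N; split.
        by apply: contra KN => /fintype.subset_trans; apply.
      by apply: rz_down rz _ _ dNK _; apply: finset.setSU.
    have s : N' \subset N :\ k by rewrite finset.subsetD1 N'N.
    apply: stellar_complexP1; first by apply: rz_down rz _ _ dN s.
    by apply: contra KN => /fintype.subset_trans; apply.
  have [dN KN] := stellar_complexN sN kN.
  apply: stellar_complexP1; first by apply: rz_down rz _ _ dN N'N.
  by apply: contra KN => /fintype.subset_trans; apply.
- move=> N sN; have [kN|kN] := boolP (k \in N).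
    have [z [Qz hz ez]] := level sN kN; exists z; split=> // i iN.
    have [->|ik] := eqVneq i k; first exact: level_minface.
    by apply: minface_trunc => //; apply: hz.2; rewrite !inE ik.
  have [dN KN] := stellar_complexN sN kN; have [y [py hy] lt] := far dN KN.
  have Qy : Q y by split=> //; apply: ltW.
  by exists y; split=> // i iN; apply: minface_trunc => //; apply: hy.
- move=> v; have [N [a [l [dN a0 aN hl ev]]]] := rz_complete rz v.
  have [KN|KN] := boolP (K \subset N); last first.
    by exists N, a, l; split=> //; apply: stellar_complexP1.
  have [i1 i1K] : exists i, i \in K by apply/finset.set0Pn.
  case: (@arg_minP _ _ _ i1 (mem K) a i1K) => i0 i0K' min.
  have i0K : i0 \in K by [].
  have t0 : 0 < a i0 by rewrite aN (fintype.subsetP KN).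
  (* The least coefficient on [K] is transferred to [u k], the sum of the rays in [K]: coefficients
     stay nonnegative and [i0] drops out, unless [i0] is [k] itself, where nothing changes. *)
  pose a' i := a i - a i0 * (i \in K)%:R + a i0 * (i == k)%:R.
  have a'0 i : 0 <= a' i.
    rewrite /a'; have [iK|iK] := boolP (i \in K).
      by rewrite mulr1 addr_ge0 ?mulr_ge0 ?subr_ge0 ?ler0n ?(ltW t0) //; apply: min.
    by rewrite mulr0 subr0 addr_ge0 ?mulr_ge0 ?(ltW t0).
  pose N2 := [set i | 0 < a' i]%SET.
  have kN2 : k \in N2.
    rewrite inE /a' eqxx mulr1; case: kK => [eK'|nk].
      by rewrite eK' inE eqxx mulr1 subrK aN (fintype.subsetP KN) // eK' inE.
    have -> : k \in K = false.
      by apply: contra_notF nk => kK'; apply: rz_down rz _ _ DK _; rewrite finset.sub1set.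
    by rewrite mulr0 subr0 ltr_wpDl.
  have sN2 : N2 :\ k \subset N.
    apply/fintype.subsetP => i; rewrite !inE => /andP[/negPf ik].
    rewrite /a' ik mulr0 addr0 -aN => /lt_le_trans; apply.
    by rewrite lerBlDr lerDl mulr_ge0 ?(ltW t0).
  exists N2, a', l; split=> //.
  + rewrite /stellar_complex /= kN2; split; last first.
      by apply: rz_down rz _ _ dN _; rewrite finset.subUset sN2.
    apply/negP => /fintype.subsetP/(_ _ i0K); rewrite !inE /a' i0K => /andP[/negPf ->].
    by rewrite mulr1 mulr0 addr0 subrr ltxx.
  + by move=> i; rewrite inE.
  rewrite ev; congr (_ + _); under [RHS]eq_bigr do rewrite /a' scalerDl scalerBl.
  rewrite big_split sumrB /=.
  have -> : \sum_i (a i0 * (i == k)%:R) *: u i = a i0 *: u k.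
    rewrite (bigD1 k) //= eqxx mulr1 big1 ?addr0 // => i /negPf ->.
    by rewrite mulr0 scale0r.
  rewrite uk [\sum_(i in K) _]sum_indicator addr0 scaler_sumr.
  under [X in _ - X + _]eq_bigr do rewrite -scalerA.
  by rewrite subrK.
move=> N j sN sj jN; have [jk|jk] := eqVneq j k.
  rewrite {}jk in jN sj *; have [dN KN] := stellar_complexN sN jN.
  have [y [py hy] lt] := far dN KN.
  have Qy : Q y by split=> //; apply: ltW.
  exists y; first by split=> // i iN; apply: minface_trunc => //; apply: hy.
  have [|z [Qz _ ez]] := level stellar_complex_set1; first by rewrite inE.
  by move=> [_ /(_ _ Qz)]; rewrite ez leNgt lt.
have [yj [dj Qyj hyj]] := other jk sj.
(* The cut leaves a point of the facet of [j], so optimality for [u j] means the same on [Q] and on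
   [P]. *)
have back x : Q x -> minface Q (u j) x -> minface P (u j) x.
  move=> Qx [_ h]; split; first exact: QP.
  by move=> z Pz; apply: le_trans (h _ Qyj) _; apply: hyj.2.
have [kN|kN] := boolP (k \in N); last first.
  have [dN KN] := stellar_complexN sN kN.
  have [y Ny lt] := far dN KN.
  have [x Nx nx] := rz_strict rz dN dj jN.
  suff [z [Qz Nz nz]] : exists z, [/\ Q z, mface u P N z & ~ minface P (u j) z].
    by exists z; [split=> // i iN; apply: minface_trunc => //; apply: Nz.2|move/(back z Qz)].
  (* If [x] was cut off, move from it towards [y] up to the cut. Since [t < 1], optimality for [u j]
     there would imply it at [x]. *)
  have [cx|xc] := leP c (dotp (u k) x); first by exists x; split=> //; split=> //; case: Nx.
  have [|t [/andP[t0 t1] hz ez]] := mface_level (rz_hconvex rz) Nx Ny (w := u k) (c := c).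
    by rewrite ltW.
  exists (x + t *: (y - x)); split=> //; first by split; [exact: hz.1|rewrite ez].
  by move/(minface_segment _ Nx.1 Ny.1) => [|/(_ t1) // _]; rewrite t0 ltW.
have [dN KN dNK] := stellar_complexW sN kN.
have jN' : j \notin N :\ k by rewrite !inE (negPf jN) andbF.
have [x0 Nx0 nx0] := rz_strict rz dN dj jN'.
have [x1 Nx1 lt1] := far dN KN.
have [x2 hx2] := rz_mface rz dNK.
have lt2 : dotp (u k) x2 < c by apply: low; apply: mfaceS (finset.subsetUr _ _) _ hx2.
have Nx2 : mface u P (N :\ k) x2 by apply: mfaceS (finset.subsetUl _ _) _ hx2.
suff [z [Nz ez nz]] : exists z, [/\ mface u P (N :\ k) z, dotp (u k) z = c & ~ minface P (u j) z].
  have Qz : Q z by split; [exact: Nz.1|rewrite ez].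
  exists z; last by move/(back z Qz).
  split=> // i iN; have [->|ik] := eqVneq i k; first exact: level_minface.
  by apply: minface_trunc => //; apply: Nz.2; rewrite !inE ik.
(* The witness [x0] must be moved onto the cut: towards [x1] if it lies on or below it, otherwise
   towards [x2] on the face cut off. In both cases it keeps positive weight, so [u j] stays
   non-optimal. *)
have [x0c|cx0] := leP (dotp (u k) x0) c.
  have [|t [/andP[t0 t1] hz ez]] := mface_level (rz_hconvex rz) Nx0 Nx1 (w := u k) (c := c).
    by rewrite x0c.
  exists (x0 + t *: (x1 - x0)); split=> //.
  by move/(minface_segment _ Nx0.1 Nx1.1) => [|/(_ t1) // _]; rewrite t0 ltW.
have [|t [/andP[t0 t1] hz ez]] := mface_level (rz_hconvex rz) Nx2 Nx0 (w := u k) (c := c).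
  by rewrite ltW.
exists (x2 + t *: (x0 - x2)); split=> //.
move/(minface_segment _ Nx2.1 Nx0.1) => [|_ h]; first by rewrite t0 ltW.
apply/nx0/h; rewrite lt_def t0 andbT; apply: contraTneq lt2 => t00.
by rewrite -ez t00 scale0r addr0 ltxx.
Qed.

End Step.
End StellarStep.

(** * Nested sets *)

Section NestedSets.
Variables (I : finType) (nf : I -> {set I}) (D0 : set {set I}).
Implicit Types (A N : {set I}) (h i j k : I).

Definition facets_over N : {set I} := [set j | [exists i in N, j \in nf i]]%SET.

(* The complex obtained by subdividing along the indices in [A], in closed form;
   it depends on [A] only and not on the order of the subdivisions. *)
Definition nested A : set {set I} :=
  [set N : {set I} | [/\ forall i, i \in N -> i \in A \/ nf i = [set i]%SET,
     D0 (facets_over N)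
   & forall h, h \in A -> nf h <> [set h]%SET ->
       ~ nf h \subset facets_over [set i in N | nf i \proper nf h]%SET]].

Lemma facets_overP N j : reflect (exists2 i, i \in N & j \in nf i) (j \in facets_over N).
Proof.
rewrite inE; apply: (iffP existsP) => [[i /andP[]]|[i iN ij]]; first by exists i.
by exists i; rewrite iN.
Qed.

Lemma facets_overS N N' : N \subset N' -> facets_over N \subset facets_over N'.
Proof.
move=> /fintype.subsetP s; apply/fintype.subsetP => j /facets_overP[i /s iN ij].
by apply/facets_overP; exists i.
Qed.

Hypothesis nf_facet : forall i j, j \in nf i -> nf j = [set j]%SET.
Hypothesis nf_neq0 : forall i, nf i != finset.set0.
Hypothesis nf_inj : injective nf.
Hypothesis D0_nf : forall i, D0 (nf i).
Hypothesis D0_down : forall N N', D0 N -> N' \subset N -> D0 N'.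
Hypothesis D0_facet : forall N i, D0 N -> i \in N -> nf i = [set i]%SET.
(** The second building set axiom in terms of facets: a common facet is a common element of [nf i]
    and [nf j], the faces meet if their union is in [D0], and that union belongs to the
    intersection. *)
Hypothesis D0_join : forall i j, nf i :&: nf j != finset.set0 ->
  D0 (nf i :|: nf j) -> exists k, nf k = nf i :|: nf j.

Lemma facets_over_facets N : (forall i, i \in N -> nf i = [set i]%SET) ->
  facets_over N = N.
Proof.
move=> h; apply/setP => j; apply/facets_overP/idP => [[i iN]|jN].
  by rewrite h // inE => /eqP ->.
by exists j; rewrite // h // inE.
Qed.

Lemma nested0 : nested finset.set0 = D0.
Proof.
apply/seteqP; split=> N.
  move=> [h1 h2 _]; rewrite facets_over_facets // in h2.
  by move=> i /h1[]; rewrite ?inE.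
move=> dN; split; last by move=> h; rewrite inE.
  by move=> i iN; right; apply: D0_facet iN.
by rewrite facets_over_facets // => i; apply: D0_facet.
Qed.

Lemma nested_set1 A j : j \in A \/ nf j = [set j]%SET -> nested A [set j]%SET.
Proof.
move=> hj; have e : facets_over [set j]%SET = nf j.
  apply/setP => i; apply/facets_overP/idP => [[k]|ij]; first by rewrite inE => /eqP ->.
  by exists j; rewrite ?inE.
split; [by move=> i; rewrite inE => /eqP ->|by rewrite e|].
move=> h hA nh /fintype.subsetP s.
have /set0Pn[i ih] := nf_neq0 h.
have /facets_overP[k] := s i ih; rewrite !inE => /andP[/eqP -> pj] _.
have : nf h \subset nf j.
  apply/fintype.subsetP => l /s /facets_overP[m].
  by rewrite !inE => /andP[/eqP -> _].
by move/(proper_sub_trans pj); rewrite fintype.properxx.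
Qed.

Section NestedStep.
Variables (A : {set I}) (k : I).
Hypothesis kA : k \notin A.
Hypothesis below : forall h, h \in A -> ~~ (nf h \proper nf k).
Hypothesis above : forall j, nf k \proper nf j -> j \in A.

Lemma nested_nf : nested A (nf k).
Proof.
split; first by move=> i /nf_facet; right.
  by rewrite facets_over_facets // => i; apply: nf_facet.
move=> h hA nh s; have {}s : nf h \subset nf k.
  rewrite -(facets_over_facets (N := nf k)); last by move=> i; apply: nf_facet.
  apply: fintype.subset_trans s _; apply: facets_overS.
  by apply/fintype.subsetP => i; rewrite inE => /andP[].
have := below hA; rewrite finset.properEneq s andbT negbK => /eqP /nf_inj e.
by move: kA; rewrite -e hA.
Qed.

Lemma nested_index : nf k = [set k]%SET \/ ~ nested A [set k]%SET.
Proof.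
have [->|nk] := pselect (nf k = [set k]%SET); [by left|right => -[h _ _]].
by have := h k; rewrite !inE eqxx => /(_ isT)[kA'|//]; move: kA; rewrite kA'.
Qed.

(** By [below], an element of [N] properly below [k] can only be a facet, so covering [nf k] amounts
    to containing it. *)
Lemma facet_in_iff N : nf k <> [set k]%SET ->
    (forall i, i \in N -> i \in k |: A \/ nf i = [set i]%SET) ->
  (nf k \subset facets_over [set i in N | nf i \proper nf k]%SET) = (nf k \subset N).
Proof.
move=> nk hN; apply/fintype.subsetP/fintype.subsetP => s j jk.
  have /facets_overP[i] := s j jk; rewrite inE => /andP[iN pi] ji.
  case: (hN i iN) => [|e]; last by move: ji; rewrite e inE => /eqP ->.
  rewrite in_setU1 => /predU1P[e|/below]; first by rewrite e fintype.properxx in pi.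
  by rewrite pi.
apply/facets_overP; exists j; last by rewrite (nf_facet jk) inE.
rewrite inE s //= (nf_facet jk) finset.properEneq finset.sub1set jk andbT.
apply/eqP => e; have := nf_facet jk; rewrite e => /nf_inj ej.
by apply: nk; rewrite -e ej.
Qed.

(* The building set property enters through [D0_join]: an index [h] in [A] whose
   facets are covered only after adding those of [k] would make the index of the
   intersection, which comes before [k], violate the condition already. *)
Lemma stellar_nested : stellar_complex k (nf k) (nested A) = nested (k |: A).
Proof.
have [fk|nk] := pselect (nf k = [set k]%SET).
  have e : nested (k |: A) = nested A.
    apply/seteqP; split=> N [h1 h2 h3]; split=> //.
    - by move=> i /h1[|]; [rewrite in_setU1 => /predU1P[->|]; [right|left]|right].
    - by move=> h hA; apply: h3; rewrite in_setU1 hA orbT.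
    - by move=> i /h1[iA|]; [left; rewrite in_setU1 iA orbT|right].
    - by move=> h; rewrite in_setU1 => /predU1P[-> //|]; apply: h3.
  rewrite e fk; apply/seteqP; split=> N; rewrite /stellar_complex /=.
    by case: ifP => kN; [rewrite finset.setUC finset.setD1K // => -[]|case].
  have [kN|kN] := boolP (k \in N) => nN; rewrite finset.sub1set.
    by rewrite finset.setUC finset.setD1K // !inE eqxx.
  by [].
have knk : k \notin nf k by apply/negP => /nf_facet.
have subD N : (nf k \subset N :\ k) = (nf k \subset N).
  by rewrite finset.subsetD1 knk andbT.
have split1 N : (forall i, i \in N -> i \in k |: A \/ nf i = [set i]%SET) ->
    k \notin N -> forall i, i \in N -> i \in A \/ nf i = [set i]%SET.
  move=> h kN i iN; case: (h i iN); last by right.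
  by rewrite in_setU1 => /predU1P[e|]; [rewrite e (negPf kN) in iN|left].
apply/seteqP; split=> N; rewrite /stellar_complex /=.
  case: ifP => kN; rewrite ?subD.
    move=> [KN [h1 h2 h3]].
    have c1 i : i \in N -> i \in k |: A \/ nf i = [set i]%SET.
      move=> iN; rewrite in_setU1; case: eqVneq => [_|ik]; first by left.
      by apply: h1; rewrite !inE ik iN.
    split=> //.
      apply: D0_down h2 _; apply/fintype.subsetP => j /facets_overP[i iN ij].
      apply/facets_overP; have [e|ik] := eqVneq i k; last by exists i; rewrite ?inE ?ik ?iN.
      by rewrite e in ij; exists j; [rewrite inE ij orbT|rewrite (nf_facet ij) inE].
    move=> h; rewrite in_setU1 => /predU1P[->|hA] nh.
      by rewrite facet_in_iff //; apply/negP.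
    move=> /fintype.subsetP s; apply: (h3 h hA nh); apply/fintype.subsetP => j /s.
    move=> /facets_overP[i]; rewrite inE => /andP[iN pi] ij; apply/facets_overP.
    have [e|ik] := eqVneq i k; last by exists i; rewrite // !inE ik iN pi.
    rewrite e in ij pi; exists j; last by rewrite (nf_facet ij) inE.
    rewrite !inE ij orbT /= (nf_facet ij).
    by apply: sub_proper_trans pi; rewrite finset.sub1set.
  move=> [[h1 h2 h3] KN]; have c1 i : i \in N -> i \in k |: A \/ nf i = [set i]%SET.
    by move/h1 => [iA|]; [left; rewrite in_setU1 iA orbT|right].
  split=> // h; rewrite in_setU1 => /predU1P[->|/h3 //] nh.
  by rewrite facet_in_iff //; apply/negP.
move=> [h1 h2 h3]; have KN : ~~ (nf k \subset N).
  by rewrite -facet_in_iff //; apply/negP/h3; rewrite ?setU11.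
case: ifP => kN; last first.
  split=> //; split=> //; first by apply: split1; rewrite ?kN.
  by move=> h hA; apply: h3; rewrite in_setU1 hA orbT.
rewrite subD; split=> //.
have foE : facets_over (N :\ k :|: nf k) \subset facets_over N.
  apply/fintype.subsetP => j /facets_overP[i].
  rewrite finset.in_setU in_setD1.
  move=> /orP[/andP[_ iN] ij|ik]; first by apply/facets_overP; exists i.
  by rewrite (nf_facet ik) finset.in_set1 => /eqP ->; apply/facets_overP; exists k.
split.
- move=> i; rewrite finset.in_setU => /orP[|/nf_facet]; last by right.
  rewrite in_setD1 => /andP[ik /h1[|]]; last by right.
  by rewrite in_setU1 (negPf ik); left.
- exact: D0_down h2 foE.
move=> h hA nh s.
have sh : nf h \subset facets_over N.
  apply: fintype.subset_trans foE; apply: fintype.subset_trans s _.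
  by apply/facets_overS/fintype.subsetP => i; rewrite inE => /andP[].
(* If [k] and [h] share no facet, the elements of [nf k] take no part in covering [nf h]. *)
have [e|ne] := eqVneq (nf k :&: nf h) finset.set0.
  apply: (h3 h); rewrite ?in_setU1 ?hA ?orbT //.
  apply/fintype.subsetP => j jh; have /facets_overP[i] := fintype.subsetP s j jh.
  rewrite finset.in_set finset.in_setU in_setD1 => /andP[/orP[/andP[_ iN]|ik] pi] ij.
    by apply/facets_overP; exists i; rewrite // inE iN.
  have : i \in nf k :&: nf h.
    by rewrite inE ik (fintype.subsetP (proper_sub pi)) // (nf_facet ik) inE.
  by rewrite e inE.
(* Otherwise [m] indexes the intersection of the two faces; it is already processed by [above], and
   [k] together with the elements below [h] covers [nf m]. *)
have [|m em] := D0_join ne.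
  apply: D0_down h2 _; rewrite finset.subUset sh andbT.
  by apply/fintype.subsetP => j jk; apply/facets_overP; exists k.
have pm : nf k \proper nf m.
  rewrite em finset.properEneq finset.subsetUl andbT; apply/eqP => ek.
  have := below hA; rewrite finset.properEneq {2}ek finset.subsetUr andbT negbK => /eqP/nf_inj e.
  by move: kA; rewrite -e hA.
have nm : nf m <> [set m]%SET.
  move=> e; move: pm (nf_neq0 k); rewrite e properE finset.sub1set subset1.
  by case/andP => /orP[/eqP ->|->//]; rewrite inE eqxx.
apply: (h3 m) => //; first by rewrite in_setU1 above ?orbT.
have viak j : j \in nf k -> j \in facets_over [set i in N | nf i \proper nf m]%SET.
  by move=> jk; apply/facets_overP; exists k; rewrite // inE kN pm.
apply/fintype.subsetP => j; rewrite {1}em finset.in_setU => /orP[/viak //|jh].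
have /facets_overP[i] := fintype.subsetP s j jh.
rewrite finset.in_set finset.in_setU in_setD1 => /andP[/orP[/andP[_ iN]|ik] pi] ij.
  apply/facets_overP; exists i; rewrite // inE iN; apply: proper_sub_trans pi _.
  by rewrite em finset.subsetUr.
by move: ij; rewrite (nf_facet ik) finset.in_set1 => /eqP ->; apply: viak.
Qed.

End NestedStep.
End NestedSets.

(** * Facet normals of a simple polytope *)

Section LinearForms.
Variables (R : realType) (n : nat).
Local Notation V := 'rV[R]_n.
Implicit Types (U W : {vspace V}) (u v x z : V).

Fact dotp_is_linear u : linear (dotp u : V -> R^o).
Proof. by move=> a x y; rewrite dotpDr dotpZr. Qed.

HB.instance Definition _ u :=
  GRing.isLinear.Build R V R^o _ (dotp u : V -> R^o) (dotp_is_linear u).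

Definition orth v : {vspace V} := lker (linfun (dotp v : V -> R^o)).

Lemma mem_orth v x : (x \in orth v) = (dotp v x == 0).
Proof. by rewrite memv_ker lfunE. Qed.

Lemma dim_cap_orth U v : (\dim U <= (\dim (U :&: orth v)).+1)%N.
Proof.
rewrite -(limg_ker_dim (linfun (dotp v : V -> R^o)) U) -[leqRHS]addn1 leq_add2l.
apply: leq_trans (dimvS (subvf _)) _.
by rewrite dimvf.
Qed.

Lemma dim_cap_orth_lt U v x : x \in U -> dotp v x != 0 ->
  (\dim (U :&: orth v) < \dim U)%N.
Proof.
move=> xU vx; rewrite ltn_neqAle dimvS ?capvSl // andbT.
apply: contra vx => /eqP e; have /eqP e' : (U :&: orth v == U)%VS.
  by rewrite eqEdim capvSl e /=.
by rewrite -mem_orth (subvP (capvSr U _)) // e'.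
Qed.

(** The form is a coordinate of the complementary projection, chosen nonzero at [z]. *)
Lemma separate_subspace W z : z \notin W ->
  exists2 v, (forall x, x \in W -> dotp v x = 0) & dotp v z != 0.
Proof.
move=> zW; pose q x := x - projv W x.
have qz : q z != 0.
  by rewrite subr_eq0; apply: contra zW => /eqP ->; apply: memv_proj.
have [i qi] : exists i, q z 0 i != 0.
  apply: contrapT => /forallNP h; move/negP: qz; apply; apply/eqP/rowP => i.
  by rewrite [RHS]mxE; apply/eqP/negPn/negP/h.
have lin a x y : q (a *: x + y) 0 i = a * q x 0 i + q y 0 i.
  by rewrite /q linearP !mxE; ring.
have rep := dotp_represents lin; exists (\row_j (q (delta_mx 0 j) 0 i)).
  by move=> x xW; rewrite dotpC -rep /q projv_id // subrr mxE.
by rewrite dotpC -rep.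
Qed.

Lemma direction_orth (P : set V) v : (forall x y, P x -> P y -> dotp v x = dotp v y) ->
  (direction P <= orth v)%VS.
Proof.
by move=> h; apply: direction_le => x y Px Py; rewrite mem_orth dotpBr (h x y) ?subrr.
Qed.

Lemma common_orth D (I : Type) (u : I -> V) (r : seq I) : exists U : {vspace V},
  [/\ (U <= D)%VS, forall x, x \in U -> all (fun i => dotp (u i) x == 0) r
    & (\dim D <= \dim U + size r)%N].
Proof.
elim: r => [|i r [U [UD Ur dU]]]; first by exists D; rewrite addn0.
exists (U :&: orth (u i))%VS; split.
- exact: subv_trans (capvSl _ _) UD.
- by move=> x; rewrite memv_cap mem_orth /= => /andP[xU ->]; apply: Ur.
rewrite /= addnS -addSn; apply: leq_trans dU _; rewrite leq_add2r.
exact: dim_cap_orth.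
Qed.

End LinearForms.

Section Facets.
Variables (R : realType) (n m : nat) (p : 'I_m.+1 -> 'rV[R]_n).
Local Notation S := (hull p).
Implicit Types (u v w x y l : 'rV[R]_n) (G : set 'rV[R]_n).

Lemma nonlineality v : ~ lineality S v ->
  exists x y, [/\ S x, S y & dotp v x != dotp v y].
Proof.
move=> nv; apply: contrapT => h; apply: nv => x y Sx Sy.
by apply/eqP/negPn/negP => ne; apply: h; exists x, y.
Qed.

Lemma dim_orth_lineality v : ~ lineality S v ->
  (\dim (direction S :&: orth v) < adim S)%N.
Proof.
move=> /nonlineality[x [y [Sx Sy ne]]].
by apply: (@dim_cap_orth_lt _ _ _ _ (x - y)); rewrite ?direction_mem // dotpBr subr_eq0.
Qed.

Lemma lineality_orth l x : lineality S l -> x \in direction S -> dotp l x = 0.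
Proof.
by move=> hl xD; apply/eqP; rewrite -mem_orth (subvP (direction_orth hl)).
Qed.

(** Passing to a strictly larger face gains a generator, so the ascent among nonconstant forms
    ends. *)
Lemma maximal_minface u : ~ lineality S u -> exists w,
  [/\ ~ lineality S w, minface S u `<=` minface S w &
    forall v, ~ lineality S v -> minface S w `<=` minface S v ->
      minface S v `<=` minface S w].
Proof.
pose c v := #|[set i | `[< ~ minface S v (p i) >]]%SET|.
have [k] := ubnP (c u); elim: k u => // k IH u; rewrite ltnS => cu nu.
have [h|] := pselect (forall v, ~ lineality S v -> minface S u `<=` minface S v ->
      minface S v `<=` minface S u); first by exists u; split=> // x.
move=> /existsNP[v /not_implyP[nv /not_implyP[uv nvu]]].
have [i [vi ui]] : exists i, minface S v (p i) /\ ~ minface S u (p i).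
  apply: contrapT => h; apply/nvu/minface_sub_gen => i vi.
  by apply: contrapT => ui; apply: h; exists i.
have [||w [nw vw hw]] := IH v => //.
  apply: leq_trans cu; apply: proper_card; apply/properP; split.
    by apply/fintype.subsetP => j; rewrite !inE; apply: contra_not; apply: uv.
  by exists i; rewrite inE; [exact/asboolP|apply/asboolPn => nn; exact: nn].
by exists w; split=> // x /uv /vw.
Qed.

(* If the face were too small, one could tilt [u] inside the annihilator of its
   direction until a further vertex becomes optimal. *)
Lemma maximal_minface_facet u : ~ lineality S u ->
    (forall v, ~ lineality S v -> minface S u `<=` minface S v ->
      minface S v `<=` minface S u) ->
  facet S (minface S u).
Proof.
move=> nu max; have [i0 hi0] := hull_argmin p u.
split; first by apply: minface_face; exists (p i0).
have uW : (direction (minface S u) <= direction S :&: orth u)%VS.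
  rewrite subv_cap directionS ?direction_orth //; last by move=> x [].
  by move=> x y; apply: minface_eq.
apply/eqP; rewrite eqn_leq (leq_ltn_trans (dimvS uW) (dim_orth_lineality nu)) /=.
rewrite (leq_trans (dim_cap_orth (direction S) u)) // ltnS; apply: dimvS.
apply/subvP => z; rewrite memv_cap mem_orth => /andP[zD /eqP uz]; apply: contraT => zW.
have [v0 v0W v0z] := separate_subspace zW.
(* Since [u] vanishes at [z], tilting it by a form nonzero at [z] cannot make it constant on [S]. *)
have nlin a v : dotp v z != 0 -> ~ lineality S (u + a *: v) \/ a = 0.
  move=> vz; have [->|a0] := eqVneq a 0; [by right|left => /lineality_orth /(_ zD)/eqP].
  by rewrite dotpDl uz add0r dotpZl mulf_eq0 (negPf a0) (negPf vz).
have nv0 : ~ lineality S v0 by move=> /lineality_orth /(_ zD)/eqP; apply/negP.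
have [j [v [vW vz rj]]] : exists j v,
    [/\ forall x, x \in direction (minface S u) -> dotp v x = 0, dotp v z != 0
      & dotp v (p j) < dotp v (p i0)].
  apply: contrapT => h; apply: nv0.
  have e j : dotp v0 (p j) = dotp v0 (p i0).
    apply/eqP; rewrite eq_le; apply/andP; split; rewrite leNgt; apply/negP => lt.
      apply: h; exists j, (- v0); rewrite !dotpNl oppr_eq0 ltrN2; split=> // x xW.
      by rewrite dotpNl v0W ?oppr0.
    by apply: h; exists j, v0.
  have c x : S x -> dotp v0 x = dotp v0 (p i0).
    move=> Sx; apply/le_anti/andP; split.
      by rewrite -lerN2 -!dotpNl; apply: hull_ge Sx => i; rewrite !dotpNl e.
    by apply: hull_ge Sx => i; rewrite e.
  by move=> x y Sx Sy; rewrite !c.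
(* Slack and rate of descent. The least ratio [s i / r i] is the largest tilt keeping [p i0]
   optimal, and a generator attaining it becomes optimal too. *)
pose s i := dotp u (p i) - dotp u (p i0); pose r i := dotp v (p i0) - dotp v (p i).
have s0 i : 0 <= s i by rewrite subr_ge0; apply: hi0.2; apply: hull_gen.
have sr i : 0 < r i -> 0 < s i.
  move=> ri; rewrite lt_def s0 andbT; apply/eqP => si.
  have ui : minface S u (p i).
    by apply: (minface_gen hi0); rewrite -subr_ge0 -opprB -/(s i) si oppr0.
  have := vW _ (direction_mem hi0 ui); rewrite dotpBr => e.
  by rewrite /r e ltxx in ri.
have rj' : 0 < r j by rewrite subr_gt0.
case: (@arg_minP _ _ _ j (fun i => 0 < r i) (fun i => s i / r i) rj') => k rk min.
pose t := s k / r k; have t0 : 0 < t by apply: divr_gt0 => //; apply: sr.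
have diff i : dotp (u + t *: v) (p i) - dotp (u + t *: v) (p i0) = s i - t * r i.
  by rewrite !dotpDl !dotpZl /s /r; ring.
have ge i : dotp (u + t *: v) (p i0) <= dotp (u + t *: v) (p i).
  rewrite -subr_ge0 diff subr_ge0; have [ri|ri] := ltP 0 (r i).
    by rewrite -ler_pdivlMr //; apply: min.
  by apply: le_trans (s0 i); apply: mulr_ge0_le0 => //; apply: ltW.
have ti0 : minface S (u + t *: v) (p i0).
  by split; [exact: hull_gen|move=> y; apply: hull_ge].
have tk : minface S (u + t *: v) (p k).
  apply: (minface_gen ti0); rewrite -subr_le0 diff /t divfK ?subrr //.
  by rewrite gt_eqF.
have nk : ~ minface S u (p k).
  by move=> hk; have := sr k rk; rewrite /s (minface_eq hk hi0) subrr ltxx.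
case: nk; apply: (max (u + t *: v)) tk.
  by have [//|t00] := nlin t v vz; rewrite t00 ltxx in t0.
apply: minface_sub_gen => i ui; apply: (minface_gen ti0).
rewrite !dotpDl !dotpZl (minface_eq ui hi0) lerD2l ler_pM2l //.
by have := vW _ (direction_mem ui hi0); rewrite dotpBr => /eqP; rewrite subr_eq0 => /eqP ->.
Qed.

Lemma exists_facet u : ~ lineality S u -> exists2 G, facet S G & minface S u `<=` G.
Proof.
move=> /maximal_minface[w [nw s max]]; exists (minface S w) => //.
exact: maximal_minface_facet.
Qed.

(** A nonconstant form loses a dimension, so its face, which contains [G], has the same direction
    space as [G]; the form defining [G] is then constant on it. *)
Lemma facet_minface G v : facet S G -> normal_cone S G v -> ~ lineality S v ->
  minface S v = G.
Proof.
move=> [fG dG] hv nv; have [y hy] : minface S v !=set0.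
  by have [i hi] := hull_argmin p v; exists (p i).
have [u eG] := face_minface fG.
have GS : G `<=` S by rewrite eG => x [].
have Gv : G `<=` minface S v.
  by move=> x Gx; apply: (minface_supp hy); [apply: GS|apply: hv].
apply/seteqP; split=> // x vx; have [x0 Gx0] := fG.1.
have /eqP e : (direction G == direction (minface S v))%VS.
  rewrite eqEdim directionS //= -ltnS [X in (_ < X)%N]dG.
  apply: leq_ltn_trans (dim_orth_lineality nv); apply: dimvS.
  rewrite subv_cap directionS ?direction_orth //; last by move=> z [].
  by move=> z1 z2; apply: minface_eq.
have := direction_mem vx (Gv _ Gx0); rewrite -e => /(subvP (@direction_orth _ _ _ u _)).
rewrite mem_orth eG dotpBr subr_eq0 => h; have hx0 : minface S u x0 by rewrite -eG.
apply: (minface_supp hx0); first by case: vx.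
rewrite (supp_minface hx0); apply/eqP/h => z1 z2; exact: minface_eq.
Qed.

End Facets.

Section SimplePolytope.
Variables (R : realType) (n m : nat) (p : 'I_m.+1 -> 'rV[R]_n).
Local Notation S := (hull p).
Variables (I : finType) (fc : I -> set 'rV[R]_n) (u : I -> 'rV[R]_n) (Fac : {set I}).
Hypothesis facet_fc : forall G, facet S G -> exists2 i, i \in Fac & fc i = G.
Hypothesis minface_u : forall i, i \in Fac -> minface S (u i) = fc i.
Hypothesis simple : forall x, vertex S x ->
  (#|[set i in Fac | `[< fc i x >]]%SET| <= adim S)%N.
Implicit Types (v w x y l : 'rV[R]_n) (N : {set I}).

(* Subtract from [v] the largest multiple of a facet normal keeping the face of
   [v] optimal, and iterate. *)
Lemma facet_normal_decomposition v : exists a l,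
  [/\ forall i, 0 <= a i, forall i, 0 < a i -> i \in Fac /\ minface S v `<=` fc i,
      lineality S l & v = \sum_i a i *: u i + l].
Proof.
pose c v := #|[set i | `[< ~ minface S v (p i) >]]%SET|.
have [k] := ubnP (c v); elim: k v => // k IH v; rewrite ltnS => cv.
have [lv|nv] := pselect (lineality S v).
  exists (fun=> 0), v; split=> //; first by move=> i; rewrite ltxx.
  by rewrite big1 ?add0r // => i _; rewrite scale0r.
have [G fG vG] := exists_facet nv; have [g gF eg] := facet_fc fG.
have [i0 vi0] := hull_argmin p v.
have gi0 : minface S (u g) (p i0) by rewrite minface_u // eg; apply: vG.
have [j0 nj0] : exists j, ~ minface S (u g) (p j).
  apply: contrapT => /forallNP h; have [_] : facet S (minface S (u g)) by rewrite minface_u // eg.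
  have -> : minface S (u g) = S; last by move/eqP; rewrite eqn_leq ltnn.
  apply/seteqP; split=> [x []//|x Sx]; apply: (@minface_sub_gen _ _ _ p 0).
    by move=> i _; apply: contrapT; apply: h.
  by split=> // y _; rewrite !dotp0l.
pose s i := dotp v (p i) - dotp v (p i0); pose d i := dotp (u g) (p i) - dotp (u g) (p i0).
have s0 i : 0 <= s i by rewrite subr_ge0; apply: vi0.2; apply: hull_gen.
have d0 i : 0 <= d i by rewrite subr_ge0; apply: gi0.2; apply: hull_gen.
have dP i : minface S (u g) (p i) <-> d i = 0.
  split=> [h|/eqP]; first by apply/eqP; rewrite subr_eq0 (minface_eq h gi0).
  by rewrite subr_eq0 => /eqP e; apply: (minface_gen gi0); rewrite e.
have sP i : minface S v (p i) <-> s i = 0.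
  split=> [h|/eqP]; first by apply/eqP; rewrite subr_eq0 (minface_eq h vi0).
  by rewrite subr_eq0 => /eqP e; apply: (minface_gen vi0); rewrite e.
have sd i : 0 < d i -> 0 < s i.
  rewrite !lt_def d0 s0 !andbT; apply: contra => /eqP /sP vi; apply/eqP/dP.
  by rewrite minface_u // eg; apply: vG.
have dj0 : 0 < d j0 by rewrite lt_def d0 andbT; apply/eqP => /dP.
case: (@arg_minP _ _ _ j0 (fun i => 0 < d i) (fun i => s i / d i) dj0) => j dj min.
pose t := s j / d j; have t0 : 0 < t by apply: divr_gt0 => //; apply: sd.
pose w := v - t *: u g.
have diff i : dotp w (p i) - dotp w (p i0) = s i - t * d i.
  by rewrite !dotpBl !dotpZl /s /d; ring.
have wi0 : minface S w (p i0).
  split; [exact: hull_gen|move=> y; apply: hull_ge => i].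
  rewrite -subr_ge0 diff subr_ge0; have := d0 i; rewrite le_eqVlt => /predU1P[<-|di].
    by rewrite mulr0.
  by rewrite -ler_pdivlMr //; apply: min.
have sub : minface S v `<=` minface S w.
  apply: minface_sub_gen => i vi; apply: (minface_gen wi0).
  rewrite -subr_le0 diff ((sP i).1 vi) ((dP i).1 _) ?mulr0 ?subrr //.
  by rewrite minface_u // eg; apply: vG.
have wj : minface S w (p j).
  apply: (minface_gen wi0); rewrite -subr_le0 diff /t divfK ?subrr //.
  by rewrite gt_eqF.
have vj : ~ minface S v (p j) by move/sP => e; have := sd j dj; rewrite e ltxx.
have [|a [l [a0 aF hl ew]]] := IH w.
  apply: leq_trans cv; apply: proper_card; apply/properP; split.
    by apply/fintype.subsetP => i; rewrite !inE; apply: contra_not; apply: sub.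
  by exists j; rewrite inE; [exact/asboolP|apply/asboolPn => nn; exact: nn].
exists (fun i => a i + t * (i == g)%:R), l; split=> //.
- by move=> i; rewrite addr_ge0 // mulr_ge0 // ltW.
- move=> i; have [-> _|ig] := eqVneq i g; first by rewrite eg.
  by rewrite mulr0 addr0 => /aF[iF h]; split=> // x /sub; apply: h.
have -> : v = w + t *: u g by rewrite subrK.
rewrite ew addrAC; congr (_ + _); under [RHS]eq_bigr do rewrite scalerDl.
rewrite big_split /=; congr (_ + _).
rewrite (bigD1 g) //= eqxx mulr1 big1 ?addr0 // => i /negPf ->.
by rewrite mulr0 scale0r.
Qed.

Definition compatible : set {set I} :=
  [set N : {set I} | N \subset Fac /\ mface u S N !=set0].

(** Simplicity enters only through strictness: at a vertex on few enough facets there is a direction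
    into [S] that leaves the facet of [j] and stays in all the others. *)
Lemma realizes_simple : realizes S u S compatible.
Proof.
split.
- exact: hull_hconvex.
- by [].
- move=> N N' [NF [x hx]] s; split; first exact: fintype.subset_trans s NF.
  by exists x; apply: mfaceS s _ hx.
- by move=> N [].
- move=> v; have [a [l [a0 aF hl ev]]] := facet_normal_decomposition v.
  exists [set i | 0 < a i]%SET, a, l; split=> //; last by move=> i; rewrite inE.
  have [i0 vi0] := hull_argmin p v; split.
    by apply/fintype.subsetP => i; rewrite inE => /aF[].
  exists (p i0); split; first exact: hull_gen.
  by move=> i; rewrite inE => /aF[iF h]; rewrite minface_u //; apply: h.
move=> N j [NF hN] [jF _] jN; rewrite finset.sub1set in jF.
have eN := mface_sum (@subset_refl _ S) hN.
have [x [v [hx ev vx]]] := vertex_in_minface p (\sum_(i in N) u i).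
rewrite eN in hx; pose Nx := [set i in Fac | `[< fc i x >]]%SET.
have NxP i : i \in Nx -> i \in Fac /\ minface S (u i) x.
  by rewrite inE => /andP[iF /asboolP]; rewrite -minface_u.
have NNx : N \subset Nx.
  apply/fintype.subsetP => i iN; have iF := fintype.subsetP NF _ iN.
  by rewrite inE iF; apply/asboolP; rewrite -minface_u //; apply: hx.2.
have [jx|jx] := boolP (j \in Nx); last first.
  exists x => // h; move: jx; rewrite inE jF /=; apply/negP/negPn/asboolP.
  by rewrite -minface_u.
have decomp w : minface S w `<=` [set x] -> exists a l,
    [/\ forall i, 0 <= a i, forall i, i \notin Nx -> a i = 0, lineality S l
      & w = \sum_i a i *: u i + l].
  move=> s; have [a [l [a0 aF hl ew]]] := facet_normal_decomposition w.
  exists a, l; split=> // i iNx; apply/le_anti; rewrite a0 andbT leNgt.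
  apply: contra iNx => /aF[iF h]; rewrite inE iF; apply/asboolP/h.
  by have [k hk] := hull_argmin p w; have := s _ hk => /= <-.
have span w : exists b l, [/\ forall i, i \notin Nx -> b i = 0, lineality S l
      & w = \sum_i b i *: u i + l].
  have [d d0] := minface_perturb p v w; rewrite ev => s.
  have [a [l [_ a0 hl ea]]] := decomp _ s.
  have [|b [k [_ b0 hk eb]]] := decomp v; first by rewrite ev.
  exists (fun i => d^-1 * (a i - b i)), (d^-1 *: (l - k)); split.
  - by move=> i h; rewrite a0 // b0 // subrr mulr0.
  - by apply/linealityZ/linealityD => //; rewrite -scaleN1r; apply: linealityZ.
  apply: (scalerI (lt0r_neq0 d0)); rewrite scalerDr scalerA divff ?lt0r_neq0 // scale1r.
  apply: (addrI v); rewrite ea [in RHS]eb scaler_sumr.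
  under [X in _ + (X + _)]eq_bigr do
    rewrite scalerA mulrA divff ?lt0r_neq0 // mul1r scalerBl.
  rewrite sumrB; set A := \sum_i _; set B := \sum_i _.
  by rewrite [RHS]addrACA subrKC [k + _]subrKC.
(* At most [adim S - 1] forms remain without [j], so they have a nonzero common zero in the
   direction of [S]. *)
have [U [UD UN dU]] := common_orth (direction S) u (enum (Nx :\ j)).
have U0 : U != 0%VS.
  rewrite -dimv_eq0 -lt0n -(ltn_add2r (size (enum (Nx :\ j)))) add0n.
  apply: leq_trans dU; rewrite -cardE; apply: leq_trans (simple vx).
  by rewrite (cardsD1 j Nx) jx.
pose e0 := vpick U; have eU : e0 \in U by apply: memv_pick.
have eD := subvP UD _ eU.
have e00 : e0 != 0 by rewrite vpick0.
have uN i : i \in Nx -> i != j -> dotp (u i) e0 = 0.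
  move=> iN ij; have /allP/(_ i) := UN _ eU.
  by rewrite mem_enum in_setD1 ij => /(_ iN)/eqP.
have uj : dotp (u j) e0 != 0.
  apply: contraNneq e00 => z; apply/eqP; apply: dotp_inj => w; rewrite dotp0r.
  have [b [l [b0 hl ->]]] := span w; rewrite dotpDl dotp_suml (lineality_orth hl eD) addr0.
  apply: big1 => i _; rewrite dotpZl; have [iN|/b0->] := boolP (i \in Nx); last by rewrite mul0r.
  by have [->|ij] := eqVneq i j; [rewrite z mulr0|rewrite (uN i iN ij) mulr0].
pose e := Num.sg (dotp (u j) e0) *: e0.
have ej : 0 < dotp (u j) e by rewrite dotpZr -normrEsg normr_gt0.
have eN0 i : i \in Nx -> i != j -> dotp (u i) e = 0.
  by move=> iN ij; rewrite dotpZr (uN i iN ij) mulr0.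
have le l : lineality S l -> dotp l e = 0.
  by move=> hl; rewrite dotpZr (lineality_orth hl eD) mulr0.
have Sx : S x by case: hx.
(* Inequalities tight at [x] persist along [e] for every positive [t], the others for small [t]. *)
have [|d d0 H] := @small_all R I (fun i t => i \in Fac -> supp S (u i) <= dotp (u i) (x + t *: e)).
  move=> i; have [iF|iF] := boolP (i \in Fac); last by exists 1.
  have [k hk] := hull_argmin p (u i).
  have [iN|iN] := boolP (i \in Nx).
    exists 1 => // t /andP[t0 _] _; have [_ h] := NxP i iN.
    rewrite (supp_minface h) dotpDr (dotpZr t) lerDl mulr_ge0 ?(ltW t0) //.
    by have [->|ij] := eqVneq i j; [apply: ltW|rewrite eN0].
  have lt : 0 < dotp (u i) x - supp S (u i).
    rewrite subr_gt0 lt_def (supp_le hk Sx) andbT; apply: contra iN => /eqP h.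
    by rewrite inE iF; apply/asboolP; rewrite -minface_u //; apply: minface_supp hk Sx h.
  have [d d0 hd] := lt_perturb (dotp (u i) e) lt.
  by exists d => // t /hd; rewrite dotpDr (dotpZr t) => + _; lra.
pose z := x + d *: e.
have Sz : S z.
  apply: hull_hconvex => w; have [k hk] := hull_argmin p w.
  exists (p k); first exact: hull_gen.
  have [a [l [a0 aF hl ew]]] := facet_normal_decomposition w.
  rewrite {1}ew [in leRHS]ew !dotpDl !dotp_suml dotpDr (dotpZr d) (le l hl) mulr0 addr0.
  rewrite (hl (p k) x) ?lerD2r //; last exact: hull_gen.
  apply: ler_sum => i _; rewrite !dotpZl; have := a0 i; rewrite le_eqVlt => /predU1P[<-|].
    by rewrite !mul0r.
  move=> ai; rewrite ler_pM2l //; have [iF h] := aF i ai.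
  have hki : minface S (u i) (p k) by rewrite minface_u //; apply: h.
  by rewrite -(supp_minface hki); apply: H; rewrite ?d0 ?lexx.
exists z.
  split=> // i iN; have iNx := fintype.subsetP NNx _ iN; have [_ h] := NxP _ iNx.
  apply: (minface_supp h Sz); rewrite (supp_minface h) dotpDr (dotpZr d) eN0 ?mulr0 ?addr0 //.
  by apply: contraNneq jN => <-.
move=> [_ /(_ x Sx)]; rewrite dotpDr (dotpZr d) leNgt.
by rewrite ltrDl mulr_gt0.
Qed.

End SimplePolytope.

(** * Fourier-Motzkin elimination *)

(** Either list may be empty, the case of a parameter unbounded on one side. *)
Lemma strictly_between (R : realFieldType) (A B : seq R) :
  (forall a b, a \in A -> b \in B -> a < b) ->
  exists z, (forall a, a \in A -> a < z) /\ (forall b, b \in B -> z < b).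
Proof.
have below (C : seq R) b : (forall a, a \in C -> a < b) ->
    exists2 z, (forall a, a \in C -> a < z) & z < b.
  elim: C => [|a C IH] h; first by exists (b - 1) => //; rewrite ltrBlDr ltrDl.
  have ab : a < b by apply: h; rewrite inE eqxx.
  have [|z hz zb] := IH; first by move=> x xC; apply: h; rewrite inE xC orbT.
  exists (Num.max z ((a + b) / 2)); last by rewrite gt_max zb; lra.
  move=> x; rewrite inE lt_max => /predU1P[->|/hz -> //].
  by apply/orP; right; lra.
elim: B => [|b B IH] h.
  have [|z hz _] := below A (1 + \sum_(a <- A) `|a|); last by exists z.
  move=> a aA; rewrite ltr_pwDl // (le_trans (ler_norm a)) //.
  by rewrite (big_rem a aA) /= lerDl sumr_ge0.
have [|z [hA hB]] := IH; first by move=> x y xA yB; apply: h; rewrite // inE yB orbT.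
have [|z' hz' z'b] := below A (Num.min z b).
  by move=> a aA; rewrite lt_min hA // h // inE eqxx.
move: z'b; rewrite lt_min => /andP[z'z z'b]; exists z'; split=> // y.
by rewrite inE => /predU1P[-> //|/hB]; apply: lt_trans.
Qed.

Section FourierMotzkin.
Variables (R : realType) (n : nat) (W : set ('rV[R]_n -> R)).
Local Notation Fn := ('rV[R]_n -> R).

Definition functional := {l : Fn -> R | linear_on W l}.

Lemma linear_on_comb a b (p q : functional) :
  linear_on W (fun f => a * sval p f + b * sval q f).
Proof. by case: p q => [p hp] [q hq] c f g Wf Wg /=; rewrite hp // hq //; ring. Qed.

Definition comb a b (p q : functional) : functional := exist _ _ (linear_on_comb a b p q).

Definition constraint k := (functional * 'rV[R]_k)%type.

Definition satisfies k f (z : 'rV[R]_k) (q : constraint k) : bool :=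
  0 < sval q.1 f + dotp q.2 z.

Lemma dotp_row1 (a b : 'rV[R]_1) : dotp a b = a 0 0 * b 0 0.
Proof. by rewrite /dotp big_ord_recl big_ord0 addr0. Qed.

(* One step of Fourier-Motzkin elimination: a lower bound [- e i / c i] and an
   upper bound on the eliminated parameter are compatible iff [combine i j] > 0. *)
Lemma eliminate_one k (T : finType) (q : T -> constraint (1 + k)) :
  exists (T' : finType) (q' : T' -> constraint k),
  forall f, (exists z, forall i, satisfies f z (q i)) <->
            (exists z, forall i, satisfies f z (q' i)).
Proof.
pose c i := lsubmx (q i).2 0 0.
pose combine i j := (comb (c i) (- c j) (q j).1 (q i).1,
  c i *: rsubmx (q j).2 - c j *: rsubmx (q i).2).
exists ({i | c i == 0} + {i | 0 < c i} * {j | c j < 0})%type.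
exists (fun x => match x with
  | inl i => ((q (val i)).1, rsubmx (q (val i)).2)
  | inr (i, j) => combine (val i) (val j) end) => f.
pose e (z : 'rV_k) i := sval (q i).1 f + dotp (rsubmx (q i).2) z.
have sat (a : 'rV_1) z i : satisfies f (row_mx a z) (q i) = (0 < e z i + c i * a 0 0).
  rewrite /satisfies -{1}(hsubmxK (q i).2) dotp_row_mx dotp_row1 /e /c.
  by rewrite [X in _ + X]addrC addrA.
have combE z i j : satisfies f z (combine i j) = (0 < c i * e z j - c j * e z i).
  by rewrite /satisfies /= dotpBl !dotpZl /e; congr (0 < _); ring.
split=> -[z].
  rewrite -(hsubmxK z); move: (lsubmx z) (rsubmx z) => a {}z h; exists z.
  move=> [[i /= /eqP ci]|[[i ci] [j cj]] /=].
    by have := h i; rewrite sat ci mul0r addr0.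
  rewrite combE; have := h i; have := h j; rewrite !sat => hj hi.
  have : 0 < c i * (e z j + c j * a 0 0) by apply: mulr_gt0.
  have : 0 < - c j * (e z i + c i * a 0 0) by apply: mulr_gt0; rewrite // oppr_gt0.
  by nra.
move=> h; have [a b|x [xA xB]] := @strictly_between R
    [seq - e z i / c i | i <- enum T & 0 < c i] [seq - e z i / c i | i <- enum T & c i < 0].
  move=> /mapP[i]; rewrite mem_filter => /andP[ci _] -> /mapP[j].
  rewrite mem_filter => /andP[cj _] ->.
  have := h (inr (exist _ i ci, exist _ j cj)); rewrite /= combE => lt.
  rewrite ltr_pdivrMr // mulrAC ltr_ndivlMr //; nra.
exists (row_mx (const_mx x) z) => i; rewrite sat mxE.
have [ci|ci|ci] := ltgtP (c i) 0.
- have : x < - e z i / c i by apply/xB/map_f; rewrite mem_filter ci mem_enum.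
  by rewrite ltr_ndivlMr // => lt; lra.
- have : - e z i / c i < x by apply/xA/map_f; rewrite mem_filter ci mem_enum.
  by rewrite ltr_pdivrMr // => lt; lra.
have c0 : c i == 0 by rewrite ci.
by have := h (inl (exist _ i c0)); rewrite [X in X * _]ci mul0r addr0.
Qed.

Lemma open_projection k (T : finType) (q : T -> constraint k) (C : set Fn) :
    (forall f, C f <-> W f /\ exists z, forall i, satisfies f z (q i)) ->
  open_polyhedral_cone W C.
Proof.
elim: k T q => [|k IH] T q hC; last first.
  have [T' [q' h]] := eliminate_one q; apply: (IH T' q') => f.
  by rewrite hC; split=> -[Wf /h].
exists #|T|, (fun i => sval (q (enum_val i)).1); split=> [i|]; first exact: svalP.
apply/seteqP; split=> f.
  move=> /hC[Wf [z h]]; split=> // i; have := h (enum_val i).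
  by rewrite /satisfies thinmx0 dotp0l addr0.
move=> [Wf h]; apply/hC; split=> //; exists 0 => i.
by rewrite /satisfies dotp0r addr0 -(enum_rankK i).
Qed.

(** For small [t] the function [t * f + g0] stays in the cone, and [f] is a multiple of its
    difference with [g0]. *)
Lemma open_cone_full (C : set Fn) :
    (forall a f g, W f -> W g -> W (fun u => a * f u + g u)) ->
  open_polyhedral_cone W C -> C !=set0 -> full_dimensional W C.
Proof.
move=> WC [m [l [linl eC]]] C0; split=> // f Wf; have [g0] := C0.
rewrite eC => -[Wg hg].
have [i|t t0 ht] := @small_all R 'I_m (fun i t => 0 < l i (fun u => t * f u + g0 u)).
  have [d d0 hd] := lt_perturb (l i f) (hg i).
  by exists d => // t /hd; rewrite linl // addrC.
pose g1 u := t * f u + g0 u.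
exists 2%N, (fun i => if i == ord0 then t^-1 else - t^-1), (fun i => if i == ord0 then g1 else g0).
split=> [i|].
  case: eqP => _; split=> //; first exact: WC.
  by move=> j; apply: ht; rewrite t0 lexx.
apply/funext => u; rewrite !big_ord_recl big_ord0 /= /g1.
by rewrite mulrDr mulrA mulVf ?gt_eqF // mul1r addr0 mulNr addrK.
Qed.

End FourierMotzkin.

(** * Sequences of truncations *)

Section TruncationSequence.
Variables (R : realType) (n : nat) (I : finType) (S : set 'rV[R]_n).
Variables (nu : set 'rV[R]_n -> 'rV[R]_n) (fc : I -> set 'rV[R]_n).
Variables (nf : I -> {set I}) (D0 : set {set I}).
Variable u : I -> 'rV[R]_n.
Hypothesis u_fc : forall i, u i = face_normal S nu (fc i).
Hypothesis fc_inj : injective fc.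
Hypothesis nf_facet : forall i j, j \in nf i -> nf j = [set j]%SET.
Hypothesis nf_neq0 : forall i, nf i != finset.set0.
Hypothesis nf_inj : injective nf.
Hypothesis D0_nf : forall i, D0 (nf i).
Hypothesis D0_down : forall N N' : {set I}, D0 N -> N' \subset N -> D0 N'.
Hypothesis D0_facet : forall (N : {set I}) i, D0 N -> i \in N -> nf i = [set i]%SET.
Hypothesis D0_join : forall i j, nf i :&: nf j != finset.set0 ->
  D0 (nf i :|: nf j) -> exists k, nf k = nf i :|: nf j.
Hypothesis rz0 : realizes S u S D0.
Hypothesis u_nf : forall i, u i = \sum_(j in nf i) u j.
Hypothesis fc_nf : forall i, fc i = mface u S (nf i).
Variable y0 : 'rV[R]_n.
Hypothesis Sy0 : S y0.
Implicit Types (P Q : set 'rV[R]_n) (A N : {set I}) (e : set 'rV[R]_n -> R).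

Local Notation nest := (nested nf D0).

(** Depths are measured from [S], as the minimum of [u j] is still that over [S] when [j] is cut.
    Facets not yet cut keep their support number. *)
Definition offset e A j : R := supp S (u j) + (if j \in A then e (fc j) else 0).

Definition stage e A P : Prop := realizes S u P (nest A) /\
  forall j, j \in A \/ nf j = [set j]%SET -> supp P (u j) = offset e A j.

(** What an order extending inclusion gives when [k] is next: no larger face is processed, every
    smaller one is. *)
Definition admissible A k : Prop := [/\ k \notin A,
  forall h, h \in A -> ~~ (nf h \proper nf k) &
  forall j, nf k \proper nf j -> j \in A].

(* [(fun=> 0, 0)] when [u k] is not in the span of [N] and the lineality space. *)
Definition coefs N k : (I -> R) * 'rV[R]_n :=
  xget (fun=> 0, 0) [set bl | [/\ forall i, i \notin N -> bl.1 i = 0,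
     lineality S bl.2 & u k = \sum_i bl.1 i *: u i + bl.2]].

(** Spanning replaces the condition that [N] be dual to a vertex, so that no intermediate polytope
    is mentioned and the set of constraints does not depend on the depths. *)
Definition constrains A k N : Prop :=
  [/\ nest A N, ~~ (nf k \subset N) & in_span S u N (u k)].

(* The right-hand side is the value of [u k] at the vertex dual to [N] of the
   current polytope, so the condition is linear in the truncation depths [e]. *)
Definition room e A k : Prop := 0 < e (fc k) /\
  forall N, constrains A k N -> supp S (u k) + e (fc k) <
    \sum_i (coefs N k).1 i * offset e A i + dotp (coefs N k).2 y0.

Lemma stage0 e : stage e finset.set0 S.
Proof.
split; first by rewrite (nested0 D0_facet).
by move=> j _; rewrite /offset inE addr0.
Qed.

Section Step.
Variables (e : set 'rV[R]_n -> R) (A : {set I}) (k : I) (P : set 'rV[R]_n).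
Hypotheses (adm : admissible A k) (rzP : realizes S u P (nest A)).

Let kA : k \notin A. Proof. by case: adm. Qed.
Let below h : h \in A -> ~~ (nf h \proper nf k). Proof. by case: adm => _ + _; apply. Qed.
Let above j : nf k \proper nf j -> j \in A. Proof. by case: adm => _ _; apply. Qed.

Lemma nest_nf : nest A (nf k).
Proof. exact: nested_nf. Qed.

Lemma facet_unprocessed j : j \in nf k -> j \notin A.
Proof.
move=> jk; apply/negP => jA; have := below jA; rewrite finset.properEneq.
rewrite (nf_facet jk) finset.sub1set jk andbT negbK => /eqP ej.
have ejk : nf j = nf k by rewrite (nf_facet jk).
by move: kA; rewrite -(nf_inj ejk) jA.
Qed.

(** The facets through the face of [k] are listed no earlier than [k], so their hyperplanes have not
    moved. *)
Lemma stage_face : stage e A P -> fc k `&` P = mface u P (nf k).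
Proof.
move=> [_ hP]; have h j : j \in nf k -> supp P (u j) = supp S (u j).
  move=> jk; rewrite hP; last by right; apply: nf_facet jk.
  by rewrite /offset (negPf (facet_unprocessed jk)) addr0.
rewrite fc_nf; apply/seteqP; split=> x.
  move=> [[_ hx] Px]; split=> // j jk; have [y hy] := minface_neq0 rzP (u j).
  by apply: (minface_supp hy Px); rewrite h // (supp_minface (hx j jk)).
move=> [Px hx]; have Sx := rz_sub rzP Px; split=> //; split=> // j jk.
have [y hy] := minface_neq0 rz0 (u j).
by apply: (minface_supp hy Sx); rewrite -h // (supp_minface (hx j jk)).
Qed.

Lemma minface_index : minface P (u k) = mface u P (nf k).
Proof.
rewrite u_nf (mface_sum (rz_sub rzP)) //; apply: rz_mface rzP _ nest_nf.
Qed.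

Lemma supp_unprocessed : stage e A P -> supp P (u k) = supp S (u k).
Proof.
move=> st; have [x hx] := rz_mface rzP nest_nf.
have [fx _] : (fc k `&` P) x by rewrite stage_face.
rewrite -minface_index in hx; rewrite (supp_minface hx); apply/esym/supp_minface.
by rewrite u_nf (mface_sum (rz_sub rz0)) -?fc_nf //; exists x.
Qed.

Lemma stage_shallow r : stage e A P ->
  shallow r P (fc k `&` P) (u k) <-> roomy u P (nest A) r (nf k) (u k).
Proof.
by move=> st; rewrite stage_face // u_nf; apply: shallowP rzP _ _ nest_nf.
Qed.

Lemma realizes_next r : roomy u P (nest A) r (nf k) (u k) ->
  realizes S u (truncation r P (u k)) (nest (k |: A)).
Proof.
move=> rm; rewrite -stellar_nested //.
by apply: realizes_truncation => //; [exact: nest_nf|exact: nested_index].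
Qed.

Lemma exists_next : exists r, roomy u P (nest A) r (nf k) (u k).
Proof. by apply: exists_roomy rzP nest_nf _ => //. Qed.

Lemma stellar_next :
  stellar [set ucone S u N | N in nest A] (normal_cone S (fc k)) (u k) =
  [set ucone S u N | N in nest (k |: A)].
Proof.
rewrite fc_nf (normal_cone_mface rz0) // (stellar_ucone rzP nest_nf) ?stellar_nested //.
exact: nested_index.
Qed.

Lemma stage_next : stage e A P -> roomy u P (nest A) (e (fc k)) (nf k) (u k) ->
  stage e (k |: A) (truncation (e (fc k)) P (u k)).
Proof.
move=> st rm; split; first exact: realizes_next.
move=> j hj; have [->|jk] := eqVneq j k.
  rewrite (supp_truncation rzP nest_nf (nf_neq0 k) (u_nf k) rm).
  by rewrite supp_unprocessed // /offset setU11.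
have hj' : j \in A \/ nf j = [set j]%SET.
  by case: hj => [|]; [rewrite in_setU1 (negPf jk); left|right].
rewrite (supp_truncation_other rm jk).
  by rewrite st.2 // /offset in_setU1 (negPf jk).
by rewrite stellar_nested //; apply: nested_set1 hj.
Qed.

Lemma span_value N x b l v : stage e A P -> nest A N -> mface u P N x ->
    (forall i, i \notin N -> b i = 0) -> lineality S l ->
    v = \sum_i b i *: u i + l ->
  dotp v x = \sum_i b i * offset e A i + dotp l y0.
Proof.
move=> st nN hx bN hl ->; rewrite dotpDl dotp_suml; congr (_ + _); last first.
  by apply: hl => //; apply: (rz_sub rzP); case: hx.
apply: eq_bigr => i _; rewrite dotpZl; have [iN|/bN ->] := boolP (i \in N); last by rewrite !mul0r.
rewrite -(supp_minface (hx.2 i iN)) st.2 //.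
by case: nN => + _ _; apply.
Qed.

Lemma coefsP N : in_span S u N (u k) -> [/\ forall i, i \notin N -> (coefs N k).1 i = 0,
  lineality S (coefs N k).2 & u k = \sum_i (coefs N k).1 i *: u i + (coefs N k).2].
Proof.
move=> [b [l h]]; rewrite /coefs; apply: (@xgetPex _ (fun=> 0, 0) [set bl : (I -> R) * _ |
  [/\ forall i, i \notin N -> bl.1 i = 0, lineality S bl.2 & u k = \sum_i bl.1 i *: u i + bl.2]]).
by exists (b, l).
Qed.

(** When [u k] lies in the span of [N], it is constant on the face of [N], with value read off the
    offsets. Conversely, checking vertices is enough by [shallowP]. *)
Lemma roomy_room : stage e A P ->
  roomy u P (nest A) (e (fc k)) (nf k) (u k) <-> room e A k.
Proof.
move=> st; split=> -[e0 h]; last first.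
  rewrite (u_nf k); apply/(shallowP rzP _ nest_nf); rewrite -u_nf; split=> // x y _ _ vy ny _.
  have [N nN eN] := vertex_mface rzP vy.
  have hy : mface u P N y by rewrite eN.
  have sp := vertex_span rzP (u k) nN eN.
  rewrite ltrBrDl supp_unprocessed //; have [b0 hl ek] := coefsP sp.
  rewrite (span_value st nN hy b0 hl ek); apply: h; split=> //.
  by apply/negP => s; apply/ny/(mfaceS s).
split=> // N [nN kN sp]; have [y hy] := h N nN kN.
have [b0 hl ek] := coefsP sp.
by rewrite (span_value st nN hy b0 hl ek) supp_unprocessed.
Qed.

End Step.

Section Listing.
Variable t0 : seq I.
Hypothesis t0_uniq : uniq t0.
Hypothesis t0_all : forall i, i \in t0.
Hypothesis t0_order : forall i j, nf j \subset nf i -> (index i t0 <= index j t0)%N.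

Definition before k : {set I} := [set i | (index i t0 < index k t0)%N]%SET.

Lemma before_prefix s1 k t : t0 = s1 ++ k :: t ->
  before k = [set i in s1]%SET /\ admissible (before k) k.
Proof.
move=> et; have ek : index k t0 = size s1.
  rewrite et index_cat /= eqxx addn0; case: ifP => // ks.
  by move: t0_uniq; rewrite et cat_uniq /= ks andbF.
split.
  apply/setP => i; rewrite !inE ek et index_cat; case: ifP => is1.
    by rewrite index_mem.
  by rewrite ltnNge leq_addr.
split=> [|h|j pj]; rewrite inE ?ltnn //.
  move=> hk; apply/negP => /proper_sub /t0_order.
  by rewrite leqNgt hk.
rewrite ltn_neqAle (t0_order (proper_sub pj)) andbT.
apply: contraTneq pj => /(congr1 (nth k t0)); rewrite !nth_index // => ->.
by rewrite fintype.properxx.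
Qed.

Lemma before_next s1 k t : t0 = s1 ++ k :: t ->
  [set i in rcons s1 k]%SET = k |: before k.
Proof.
by move=> /before_prefix[-> _]; apply/setP => i; rewrite !inE mem_rcons inE.
Qed.

Lemma processed_all : [set i in t0]%SET = finset.setT.
Proof. by apply/setP => i; rewrite !inE t0_all. Qed.

Lemma shallow_truncationsP e Q : shallow_truncations S nu e (map fc t0) S Q ->
  stage e finset.setT Q /\ forall k, room e (before k) k.
Proof.
suff H t s1 P : t0 = s1 ++ t -> stage e [set i in s1]%SET P ->
    shallow_truncations S nu e (map fc t) P Q ->
    stage e finset.setT Q /\ forall k, k \in t -> room e (before k) k.
  move=> h; have [|st r] := H t0 [::] S erefl _ h; last by split=> // k; apply: r.
  have -> : [set i in [::]]%SET = finset.set0 :> {set I} by apply/setP => i; rewrite !inE.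
  exact: stage0.
elim: t s1 P => [|k t IH] s1 P et st /=.
  by rewrite cats0 in et; rewrite -et processed_all in st => ->.
have [eb adm] := before_prefix et; rewrite -eb in st; rewrite -u_fc => -[sh h].
have rm := (stage_shallow adm st.1 (e (fc k)) st).1 sh.
have st' := stage_next adm st.1 st rm; rewrite -(before_next et) in st'.
have [|stQ r] := IH _ _ _ st' h; first by rewrite cat_rcons.
split=> // j; rewrite inE => /predU1P[->|/r //].
exact/(roomy_room adm st.1 st).
Qed.

Lemma room_truncations e : (forall k, room e (before k) k) ->
  exists Q, shallow_truncations S nu e (map fc t0) S Q.
Proof.
move=> r; suff H t s1 P : t0 = s1 ++ t -> stage e [set i in s1]%SET P ->
    exists Q, shallow_truncations S nu e (map fc t) P Q.
  apply: (H t0 [::] S erefl).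
  have -> : [set i in [::]]%SET = finset.set0 :> {set I} by apply/setP => i; rewrite !inE.
  exact: stage0.
elim: t s1 P => [|k t IH] s1 P et st /=; first by exists P.
have [eb adm] := before_prefix et; rewrite -eb in st.
have rm := (roomy_room adm st.1 st).2 (r k).
have st' := stage_next adm st.1 st rm; rewrite -(before_next et) in st'.
have [|Q h] := IH _ _ _ st'; first by rewrite cat_rcons.
by exists Q; rewrite -u_fc; split=> //; apply/(stage_shallow adm st.1 (e (fc k)) st).
Qed.

(** A depth can be chosen only once the current polytope is known, so the induction modifies [e] as
    it goes; agreement off the remaining list protects earlier choices. *)
Lemma exists_truncation : exists e Q, shallow_truncations S nu e (map fc t0) S Q.
Proof.
suff H t s1 e P : t0 = s1 ++ t -> stage e [set i in s1]%SET P ->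
    exists e' Q, (forall F, ~~ has (fun k => `[< F = fc k >]) t -> e' F = e F) /\
      shallow_truncations S nu e' (map fc t) P Q.
  have [|e [Q [_ h]]] := H t0 [::] (fun=> 0) S erefl; last by exists e, Q.
  have -> : [set i in [::]]%SET = finset.set0 :> {set I} by apply/setP => i; rewrite !inE.
  exact: stage0.
elim: t s1 e P => [|k t IH] s1 e P et st /=; first by exists e, P.
have [eb adm] := before_prefix et; rewrite -eb in st.
have [r rm] := exists_next adm st.1.
pose e1 F := if `[< F = fc k >] then r else e F.
have e1k : e1 (fc k) = r by rewrite /e1 asboolT.
have kA : k \notin before k by case: adm.
have st1 : stage e1 (before k) P.
  split; first exact: st.1.
  move=> j hj; rewrite st.2 // /offset; congr (_ + _); case: ifP => // jA.
  rewrite /e1 asboolF // => /fc_inj ej; by rewrite ej (negPf kA) in jA.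
have st' := stage_next adm st.1 st1; rewrite e1k -(before_next et) in st'.
have [|e2 [Q [h2 h]]] := IH _ _ _ _ (st' rm); first by rewrite cat_rcons.
have e2k : e2 (fc k) = r.
  rewrite h2 ?e1k //; apply/negP => /hasP[j jt /asboolP /fc_inj ej].
  by move: t0_uniq; rewrite et cat_uniq /= ej jt !andbF.
exists e2, Q; split.
  by move=> F; rewrite negb_or => /andP[Fk Ft]; rewrite h2 // /e1 (negPf Fk).
rewrite e2k -u_fc; split=> //.
exact/(stage_shallow adm st.1 _ st).
Qed.

(** Each subdivision step compares cones through a polytope realizing the current complex, so some
    sequence of truncations is run alongside the fan. *)
Lemma stellar_fan_listing :
  stellar_fan S nu (map fc t0) = [set ucone S u N | N in nest finset.setT].
Proof.
have e0 : [set i in [::]]%SET = finset.set0 :> {set I} by apply/setP => i; rewrite !inE.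
have -> : stellar_fan S nu (map fc t0) = foldl (fun Gamma F =>
    stellar Gamma (normal_cone S F) (face_normal S nu F))
    [set ucone S u N | N in nest [set i in [::]]%SET] (map fc t0).
  by rewrite e0 (nested0 D0_facet) -(normal_fan_realizes rz0).
suff H t s1 P : t0 = s1 ++ t -> realizes S u P (nest [set i in s1]%SET) ->
    foldl (fun Gamma F => stellar Gamma (normal_cone S F) (face_normal S nu F))
      [set ucone S u N | N in nest [set i in s1]%SET] (map fc t) =
    [set ucone S u N | N in nest finset.setT].
  apply: (H t0 [::] S erefl).
  by rewrite e0 (nested0 D0_facet).
elim: t s1 P => [|k t IH] s1 P et rz /=.
  by rewrite cats0 in et; rewrite -et processed_all.
have [eb adm] := before_prefix et; rewrite -eb in rz *.
rewrite -u_fc (stellar_next adm rz) -(before_next et).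
have [r rm] := exists_next adm rz.
apply: (IH _ (truncation r P (u k))); first by rewrite cat_rcons.
by rewrite (before_next et); exact: (realizes_next adm rz rm).
Qed.

End Listing.
End TruncationSequence.

(** * The cone of truncations *)

Section Homothety.
Variables (R : realType) (n : nat) (r : R) (t : 'rV[R]_n).
Hypothesis r0 : 0 < r.
Implicit Types (P S : set 'rV[R]_n) (w x : 'rV[R]_n).

Definition homothety P : set 'rV[R]_n := [set r *: x + t | x in P].

Lemma dotp_homothety w x y :
  (dotp w (r *: x + t) <= dotp w (r *: y + t)) = (dotp w x <= dotp w y).
Proof. by rewrite !dotpDr !dotpZr lerD2r ler_pM2l. Qed.

Lemma homothety_inj x y : r *: x + t = r *: y + t -> x = y.
Proof. by move=> /addIr /(scalerI (lt0r_neq0 r0)). Qed.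

Lemma mem_homothety P x : homothety P (r *: x + t) <-> P x.
Proof. by split=> [[y Py /homothety_inj <-]|Px] //; exists x. Qed.

Lemma minface_homothety P w x :
  minface (homothety P) w (r *: x + t) <-> minface P w x.
Proof.
split=> [[/mem_homothety Px h]|[Px h]].
  by split=> // y Py; rewrite -dotp_homothety; apply: h; exists y.
by split=> [|_ [y Py <-]]; [exists x|rewrite dotp_homothety; apply: h].
Qed.

Lemma supp_homothety P w : minface P w !=set0 ->
  supp (homothety P) w = r * supp P w + dotp w t.
Proof.
move=> [x hx]; rewrite (supp_minface hx) (supp_minface ((minface_homothety _ _ _).2 hx)).
by rewrite dotpDr dotpZr.
Qed.

Lemma lineality_homothety P : lineality (homothety P) = lineality P.
Proof.
apply/seteqP; split=> l h x y.
  move=> Px Py; have : dotp l (r *: x + t) = dotp l (r *: y + t).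
    by apply: h; apply/mem_homothety.
  by rewrite !dotpDr !dotpZr => /addIr /(mulfI (lt0r_neq0 r0)).
by move=> [x' Px <-] [y' Py <-]; rewrite !dotpDr !dotpZr (h x' y').
Qed.

(** [S] is moved along with [P] to keep the inclusion; the cones depend on [S] only through its
    lineality space, which is unchanged. *)
Lemma realizes_homothety (I : finType) S (u : I -> 'rV[R]_n) P (D : set {set I}) :
  realizes S u P D -> realizes (homothety S) u (homothety P) D.
Proof.
move=> rz; have mf N x : mface u (homothety P) N (r *: x + t) <-> mface u P N x.
  split=> -[Px h].
    split=> [|i iN]; first exact: (mem_homothety P x).1.
    by apply: (minface_homothety _ _ _).1; apply: h.
  split=> [|i iN]; first exact: (mem_homothety P x).2.
  by apply: (minface_homothety _ _ _).2; apply: h.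
split.
- move=> x hx; have ex : x = r *: (r^-1 *: (x - t)) + t.
    by rewrite scalerA divff ?lt0r_neq0 // scale1r subrK.
  rewrite ex; apply/mem_homothety/(rz_hconvex rz) => w.
  have [_ [y Py <-] le] := hx w; exists y => //.
  by rewrite -dotp_homothety -ex.
- by move=> _ [x Px <-]; apply/mem_homothety/(rz_sub rz).
- exact: rz_down rz.
- by move=> N dN; have [x hx] := rz_mface rz dN; exists (r *: x + t); apply/mf.
- by move=> v; rewrite lineality_homothety; apply: rz_complete rz v.
move=> N j dN dj jN; have [x hx nx] := rz_strict rz dN dj jN.
by exists (r *: x + t); [apply/mf|move/minface_homothety].
Qed.

End Homothety.

(** The projection separates the part of the translation that [f] determines from the free part.
    Differences of generators give finitely many equations for the lineality space. *)
Lemma exists_lineality_projection (R : realType) (n m : nat) (p : 'I_m.+1 -> 'rV[R]_n) :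
  exists pr : 'rV[R]_n -> 'rV[R]_n,
    [/\ linear pr, forall x, lineality (hull p) (pr x)
      & forall l, lineality (hull p) l -> pr l = l].
Proof.
have [U hU] : exists U : {vspace 'rV[R]_n}, forall x,
    (x \in U) = all (fun d => dotp d x == 0) [seq p i - p ord0 | i <- enum 'I_m.+1].
  elim: [seq _ | _ <- _] => [|d r [U hU]]; first by exists fullv => x; rewrite memvf.
  by exists (orth d :&: U)%VS => x; rewrite memv_cap mem_orth hU.
have UP x : x \in U <-> lineality (hull p) x.
  rewrite hU; split=> [/allP h|h].
    have e i : dotp x (p i) = dotp x (p ord0).
      have := h _ (map_f _ (mem_enum _ i)); rewrite dotpC dotpBr subr_eq0 => /eqP.
      by apply.
    have c y : hull p y -> dotp x y = dotp x (p ord0).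
      move=> Sy; apply/le_anti/andP; split.
        by rewrite -lerN2 -!dotpNl; apply: hull_ge Sy => i; rewrite !dotpNl e.
      by apply: hull_ge Sy => i; rewrite e.
    by move=> y z Sy Sz; rewrite !c.
  apply/allP => _ /mapP[i _ ->]; rewrite dotpC dotpBr (h _ (p ord0)) ?subrr //.
    exact: hull_gen.
  exact: hull_gen.
exists (projv U); split.
- by move=> a x y; rewrite linearP.
- by move=> x; apply/UP; apply: memv_proj.
by move=> l /UP lU; rewrite projv_id.
Qed.

Section TCone.
Variables (R : realType) (n : nat) (I : finType) (S : set 'rV[R]_n).
Variables (nu : set 'rV[R]_n -> 'rV[R]_n) (fc : I -> set 'rV[R]_n).
Variables (nf : I -> {set I}) (D0 : set {set I}) (u : I -> 'rV[R]_n).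
Hypothesis u_fc : forall i, u i = face_normal S nu (fc i).
Hypothesis fc_inj : injective fc.
Hypothesis nf_facet : forall i j, j \in nf i -> nf j = [set j]%SET.
Hypothesis nf_neq0 : forall i, nf i != finset.set0.
Hypothesis nf_inj : injective nf.
Hypothesis D0_nf : forall i, D0 (nf i).
Hypothesis D0_down : forall N N' : {set I}, D0 N -> N' \subset N -> D0 N'.
Hypothesis D0_facet : forall (N : {set I}) i, D0 N -> i \in N -> nf i = [set i]%SET.
Hypothesis D0_join : forall i j, nf i :&: nf j != finset.set0 ->
  D0 (nf i :|: nf j) -> exists k, nf k = nf i :|: nf j.
Hypothesis rz0 : realizes S u S D0.
Hypothesis u_nf : forall i, u i = \sum_(j in nf i) u j.
Hypothesis fc_nf : forall i, fc i = mface u S (nf i).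
Variable y0 : 'rV[R]_n.
Hypothesis Sy0 : S y0.
Variable t0 : seq I.
Hypothesis t0_uniq : uniq t0.
Hypothesis t0_all : forall i, i \in t0.
Hypothesis t0_order : forall i j, nf j \subset nf i -> (index i t0 <= index j t0)%N.
Variable pr : 'rV[R]_n -> 'rV[R]_n.
Hypothesis pr_linear : linear pr.
Hypothesis pr_lineality : forall x, lineality S (pr x).
Hypothesis pr_id : forall l, lineality S l -> pr l = l.

Local Notation D := (nested nf D0 finset.setT).
Local Notation Gamma := [set ucone S u N | N in D].
Local Notation T := (T_cone S nu (map fc t0)).
Local Notation W := (PL Gamma).
Local Notation bef := (before t0).
Implicit Types (f : 'rV[R]_n -> R) (z v : 'rV[R]_n) (kappa : I -> R).

(* If [f] is the support function of [lambda *: P + v], then [f] determines [v]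
   on the lineality space; [lin_part] is the form [dotp ^~ v] so constrained, with
   [z] a free parameter, and [height] is [lambda] times the support number of [P]. *)
Definition lin_part f lambda z v : R :=
  f (pr v) - lambda * dotp (pr v) y0 + dotp (v - pr v) z.

Definition height f lambda z i : R := f (u i) - lin_part f lambda z (u i).

Lemma linear_on_heights kappa :
  linear_on W (fun f => \sum_i kappa i * (f (u i) - f (pr (u i)))).
Proof.
move=> a f g _ _; rewrite mulr_sumr -big_split; apply: eq_bigr => i _ /=; ring.
Qed.

(** The first parameter is lambda, the other [n] are the free translation [z]; the constant [c]
    becomes a coefficient of lambda. *)
Definition height_constraint kappa c : constraint W (1 + n) :=
  (exist _ _ (linear_on_heights kappa),
   row_mx (const_mx (\sum_i kappa i * dotp (pr (u i)) y0 + c))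
          (- \sum_i kappa i *: (u i - pr (u i)))).

Lemma satisfies_height f (a : 'rV_1) z kappa c :
  satisfies f (row_mx a z) (height_constraint kappa c) =
  (0 < \sum_i kappa i * height f (a 0 0) z i + a 0 0 * c).
Proof.
rewrite /satisfies /= dotp_row_mx dotp_row1 mxE dotpNl dotp_suml; congr (0 < _).
rewrite mulrDl mulr_suml [c * _]mulrC [_ + a 0 0 * c - _]addrAC addrA; congr (_ + _).
rewrite -sumrB -big_split; apply: eq_bigr => i _ /=.
by rewrite dotpZl /height /lin_part; ring.
Qed.

(** The empty simplex belongs to [D], because some truncation realizes [D], and its cone is the
    lineality space. *)
Lemma PL_lineality f : W f -> exists x, forall l, lineality S l -> f l = dotp l x.
Proof.
move=> Wf; have d0 : D finset.set0.
  have [e [Q h]] := exists_truncation u_fc fc_inj nf_facet nf_neq0 nf_inj D0_nf D0_down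
    D0_facet D0_join rz0 u_nf fc_nf t0_uniq t0_all t0_order.
  have [[rz _] _] := shallow_truncationsP u_fc nf_facet nf_neq0 nf_inj D0_nf D0_down D0_facet
    D0_join rz0 u_nf fc_nf Sy0 t0_uniq t0_all t0_order h.
  have [N [_ [_ [dN _ _ _ _]]]] := rz_complete rz 0.
  by apply: rz_down rz _ _ dN _; apply: finset.sub0set.
have [|x hx] := Wf (ucone S u finset.set0); first by exists finset.set0.
by exists x => l hl; apply/hx/ucone_lineality.
Qed.

(** Positivity of lambda, positivity of the depths, and the inequalities of [room], the last two
    multiplied by lambda. Pairs imposing nothing repeat the first constraint. *)
Definition T_constraint (x : unit + I + I * {set I}) : constraint W (1 + n) :=
  match x with
  | inl (inl _) => height_constraint (fun=> 0) 1
  | inl (inr k) => height_constraint (fun i => (i == k)%:R) (- supp S (u k))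
  | inr (k, N) =>
    if `[< constrains S nf D0 u (bef k) k N >] then
      height_constraint
        (fun i => (coefs S u N k).1 i * (i \in bef k)%:R - (i == k)%:R)
        (\sum_i (coefs S u N k).1 i * (supp S (u i) * (i \notin bef k)%:R)
          + dotp (coefs S u N k).2 y0)
    else height_constraint (fun=> 0) 1
  end.

Lemma sum_delta k (F : I -> R) : \sum_i (i == k)%:R * F i = F k.
Proof.
by rewrite (bigD1 k) //= eqxx mul1r big1 ?addr0 // => i /negPf ->; rewrite mul0r.
Qed.

Lemma T_constraintP f (a : 'rV_1) z (e : set 'rV[R]_n -> R) :
    (forall i, height f (a 0 0) z i = a 0 0 * (supp S (u i) + e (fc i))) ->
  (forall x, satisfies f (row_mx a z) (T_constraint x)) <->
  0 < a 0 0 /\ forall k, room S fc nf D0 u y0 e (bef k) k.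
Proof.
move=> he; set b := a 0 0.
have s0 : satisfies f (row_mx a z) (height_constraint (fun=> 0) 1) = (0 < b).
  by rewrite satisfies_height mulr1 big1 ?add0r // => i _; rewrite mul0r.
have s1 k : 0 < b ->
    satisfies f (row_mx a z) (T_constraint (inl (inr k))) = (0 < e (fc k)).
  move=> b0; rewrite satisfies_height sum_delta he -mulrDr pmulr_rgt0 //.
  by rewrite addrAC subrr add0r.
have s2 k N : 0 < b -> constrains S nf D0 u (bef k) k N ->
    satisfies f (row_mx a z) (T_constraint (inr (k, N))) =
    (supp S (u k) + e (fc k) <
     \sum_i (coefs S u N k).1 i * offset S fc u e (bef k) i + dotp (coefs S u N k).2 y0).
  move=> b0 c; rewrite /T_constraint asboolT // satisfies_height.
  under eq_bigr do rewrite mulrBl.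
  rewrite sumrB sum_delta he -/b -[RHS]subr_gt0 -[RHS](pmulr_rgt0 _ b0).
  have key : \sum_i (coefs S u N k).1 i * (i \in bef k)%:R * height f b z i +
      b * (\sum_i (coefs S u N k).1 i * (supp S (u i) * (i \notin bef k)%:R)) =
      b * \sum_i (coefs S u N k).1 i * offset S fc u e (bef k) i.
    rewrite !mulr_sumr -big_split; apply: eq_bigr => i _ /=.
    by rewrite he -/b /offset; case: (i \in bef k) => /=; ring.
  by congr (0 < _); rewrite mulrBr !mulrDr -key; ring.
split=> [h|[b0 h] [[[]|k]|[k N]]].
- have b0 : 0 < b by rewrite -s0; apply: (h (inl (inl tt))).
  split=> // k; split=> [|N c]; first by rewrite -s1.
  by rewrite -s2.
- by rewrite [T_constraint _]/= s0.
- by rewrite s1 //; apply: (h k).1.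
have [c|nc] := pselect (constrains S nf D0 u (bef k) k N).
  by rewrite s2 //; apply: (h k).2.
by rewrite /T_constraint asboolF // s0.
Qed.

Lemma T_coneP f : T f <->
  W f /\ exists z : 'rV[R]_(1 + n), forall x, satisfies f z (T_constraint x).
Proof.
split.
  move=> [lambda [v [P [l0 [e he] ef]]]].
  have [st r] := shallow_truncationsP u_fc nf_facet nf_neq0 nf_inj D0_nf D0_down D0_facet
    D0_join rz0 u_nf fc_nf Sy0 t0_uniq t0_all t0_order he.
  have rz := st.1; have sf := fun w => supp_homothety v l0 (minface_neq0 rz w).
  split.
    move=> _ [N dN <-]; have [x hx] := supp_linear_on (realizes_homothety v l0 rz) dN.
    exists x => w hw; rewrite ef; apply: hx.
    by move: hw; rewrite /ucone /= lineality_homothety.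
  exists (row_mx (const_mx lambda) v); apply/(T_constraintP (e := e)); rewrite mxE; last by [].
  move=> i; rewrite /height /lin_part ef !sf st.2; last by left; rewrite inE.
  have -> : supp P (pr (u i)) = dotp (pr (u i)) y0.
    have [x hx] := minface_neq0 rz (pr (u i)); rewrite (supp_minface hx).
    by apply: (pr_lineality (u i)) => //; apply: (rz_sub rz); case: hx.
  by rewrite /offset inE dotpBl; ring.
move=> [Wf [z]]; rewrite -(hsubmxK z); move: (lsubmx z) (rsubmx z) => a {}z hz.
have [x hx] := PL_lineality Wf; pose b := a 0 0.
(* As [f] is linear on the lineality space, [lin_part] is a linear form, and the vector [v]
   representing it is the translation. *)
have lin c w1 w2 : lin_part f b z (c *: w1 + w2) = c * lin_part f b z w1 + lin_part f b z w2.
  rewrite /lin_part !hx //; rewrite pr_linear !dotpBl !dotpDl !dotpZl; ring.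
have rep := dotp_represents lin; set v := \row_i _ in rep.
have b0 : 0 < b.
  have := hz (inl (inl tt)); rewrite /= satisfies_height mulr1 big1 ?add0r // => i _.
  by rewrite mul0r.
(* The depth forced by [f]: height divided by lambda, minus the support number of [S]. *)
pose e F := (f (face_normal S nu F) - dotp (face_normal S nu F) v) / b
  - supp S (face_normal S nu F).
have he i : height f b z i = b * (supp S (u i) + e (fc i)).
  rewrite /e -u_fc addrCA subrr addr0 mulrC divfK ?gt_eqF //.
  by rewrite /height rep.
have [_ r] := (T_constraintP he).1 hz.
have [Q hQ] := room_truncations u_fc nf_facet nf_neq0 nf_inj D0_nf D0_down D0_facet
    D0_join rz0 u_nf fc_nf Sy0 t0_uniq t0_all t0_order r.
have [st _] := shallow_truncationsP u_fc nf_facet nf_neq0 nf_inj D0_nf D0_down D0_facet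
    D0_join rz0 u_nf fc_nf Sy0 t0_uniq t0_all t0_order hQ.
have rz := st.1; have sf := fun w => supp_homothety v b0 (minface_neq0 rz w).
exists b, v, Q; split=> //; first by exists e.
apply: (PL_eq rz) => //.
- move=> _ [N dN <-]; have [y hy] := supp_linear_on (realizes_homothety v b0 rz) dN.
  by exists y => w hw; apply: hy; move: hw; rewrite /ucone /= lineality_homothety.
- move=> i _; rewrite sf st.2; last by left; rewrite inE.
  by rewrite /offset inE -he /height rep subrK.
move=> l hl; rewrite sf -rep /lin_part pr_id // subrr dotp0l addr0.
have [y hy] := minface_neq0 rz l; rewrite (supp_minface hy).
rewrite (hl y y0) //; last by apply: (rz_sub rz); case: hy.
by rewrite addrC subrK.
Qed.

End TCone.

(** * Building sets *)

Section DualLattice.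
Variables (R : realType) (n : nat) (M : 'M[R]_n).

Lemma dual_lattice0 : dual_lattice M 0.
Proof. by move=> x _; rewrite dotp0l. Qed.

Lemma dual_lattice_sum (I : finType) (N : {set I}) (w : I -> 'rV[R]_n) :
  (forall i, i \in N -> dual_lattice M (w i)) -> dual_lattice M (\sum_(i in N) w i).
Proof.
move=> h x hx; rewrite dotp_suml; apply: rpred_sum => i iN; exact: h.
Qed.

(** A facet is proper, hence dual to a nonempty simplex, and any of its rays is a lattice normal;
    strictness for the empty simplex makes it nonconstant. *)
Lemma realizes_polytope (I : finType) (S P : set 'rV[R]_n) (u : I -> 'rV[R]_n)
    (D : set {set I}) :
    realizes S u P D -> (forall i, dual_lattice M (u i)) -> polytope M P.
Proof.
move=> rz hu; split; first exact: realizes_hull rz.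
move=> G [fG dG]; have [w eG] := face_minface fG.
have [N dN [_ eN]] := minface_rep rz w; rewrite eN in eG.
have [i iN] : exists i, i \in N.
  apply/finset.set0Pn; apply: contra_eq_neq dG => N0; rewrite eG N0.
  have -> : mface u P finset.set0 = P.
    by apply/seteqP; split=> [x []//|x Px]; split=> // i; rewrite inE.
  by rewrite gtn_eqF.
have d0 : D finset.set0 by apply: rz_down rz _ _ dN (finset.sub0set _).
have di : D [set i]%SET by apply: rz_down rz _ _ dN _; rewrite finset.sub1set.
exists (u i); split=> //.
  by move=> x; rewrite eG => -[_ h]; apply/esym/supp_minface/h.
move=> lin; have [|x [Px _] []] := rz_strict rz d0 di (j := i); first by rewrite inE.
by split=> // y Py; rewrite (lin x y).
Qed.

End DualLattice.

Section Building.
Variables (R : realType) (n : nat) (M : 'M[R]_n) (m : nat) (p : 'I_m.+1 -> 'rV[R]_n).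
Local Notation S := (hull p).
Hypothesis hS : simple_polytope M S.
Variable nu : set 'rV[R]_n -> 'rV[R]_n.
Hypothesis hnu : facet_normals M S nu.
Variables (I : finType) (fc : I -> set 'rV[R]_n).
Hypothesis fc_inj : injective fc.
Hypothesis hB : building_set S (range fc).

Definition normals i := face_normal S nu (fc i).
Local Notation u := normals.
Definition facet_indices : {set I} := [set i | `[< facet S (fc i) >]]%SET.
Definition facets_above i : {set I} :=
  [set j | `[< facet S (fc j) /\ fc i `<=` fc j >]]%SET.
Local Notation nf := facets_above.
Local Notation D0 := (compatible p u facet_indices).

Lemma facet_indicesP i : reflect (facet S (fc i)) (i \in facet_indices).
Proof. by rewrite inE; apply: asboolP. Qed.

Lemma facets_aboveP i j : reflect (facet S (fc j) /\ fc i `<=` fc j) (j \in nf i).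
Proof. by rewrite inE; apply: asboolP. Qed.

Lemma facet_normal_minface G : facet S G -> minface S (nu G) = G.
Proof.
move=> fG; have [_ nG prim] := hnu fG; apply: facet_minface => // lin.
have := prim 0%N 0 (@dual_lattice0 _ _ M); rewrite mulr0n subr0 => /(_ lin).
by [].
Qed.

Lemma facet_subset G G' : facet S G -> facet S G' -> G `<=` G' -> G = G'.
Proof.
move=> fG fG' s; have [_ nG' prim] := hnu fG'.
rewrite -(facet_normal_minface fG'); apply/esym/facet_minface => //.
  by move=> x /s; apply: nG'.
move=> lin; have := prim 0%N 0 (@dual_lattice0 _ _ M); rewrite mulr0n subr0 => /(_ lin).
by [].
Qed.

Lemma facets_above_facet i : i \in facet_indices -> nf i = [set i]%SET.
Proof.
move=> /facet_indicesP fi; apply/setP => j; rewrite finset.in_set1.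
apply/facets_aboveP/eqP => [[fj s]|->]; last by split.
by apply/esym/fc_inj/facet_subset.
Qed.

Lemma face_normal_sum i : u i = \sum_(j in nf i) nu (fc j).
Proof.
rewrite /normals /face_normal; pose r := [seq fc j | j <- enum (nf i)].
have ur : uniq r by rewrite map_inj_uniq ?enum_uniq.
have -> : [set G | facet S G /\ fc i `<=` G] = [set` r].
  apply/seteqP; split=> G.
    move=> [fG s]; have [_ hF _] := hB; have [j _ ej] := hF G fG.
    by rewrite /= -ej map_f // mem_enum; apply/facets_aboveP; rewrite ej.
  by move=> /mapP[j]; rewrite mem_enum => /facets_aboveP[fj s] ->.
by rewrite -fsbig_seq // big_map big_enum.
Qed.

Lemma face_normal_facet i : i \in facet_indices -> u i = nu (fc i).
Proof. by move=> iF; rewrite face_normal_sum facets_above_facet // big_set1. Qed.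

Lemma facets_above_index i j : j \in nf i -> j \in facet_indices.
Proof. by move=> /facets_aboveP[fj _]; apply/facet_indicesP. Qed.

Lemma normals_sum i : u i = \sum_(j in nf i) u j.
Proof.
rewrite face_normal_sum; apply: eq_bigr => j /facets_above_index jF.
by rewrite face_normal_facet.
Qed.

Lemma minface_normal i : i \in facet_indices -> minface S (u i) = fc i.
Proof.
by move=> iF; rewrite face_normal_facet // facet_normal_minface //; apply/facet_indicesP.
Qed.

Lemma facet_index G : facet S G -> exists2 i, i \in facet_indices & fc i = G.
Proof.
move=> fG; have [_ hF _] := hB; have [j _ ej] := hF G fG.
by exists j => //; apply/facet_indicesP; rewrite ej.
Qed.

Lemma vertex_facets x : vertex S x ->
  (#|[set i in facet_indices | `[< fc i x >]]%SET| <= adim S)%N.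
Proof.
move=> vx; have [_ /(_ x vx) e] := hS; set N := finset _.
pose f (i : 'I_#|N|) := fc (enum_val i).
rewrite -card_le_II (card_le_eql card_II).
have fi : {in [set: 'I_#|N|] &, injective f}.
  by move=> i j _ _ /fc_inj /enum_val_inj.
rewrite -(card_le_eql (inj_card_eq fi)) -(card_le_eqr e).
apply: subset_card_le => _ [i _ <-]; have := enum_valP i.
by rewrite inE => /andP[/facet_indicesP fG /asboolP].
Qed.

Lemma realizes_base : realizes S u S D0.
Proof. exact: realizes_simple facet_index minface_normal vertex_facets. Qed.

Lemma facets_above_set1 i j : j \in nf i -> nf j = [set j]%SET.
Proof. by move=> /facets_above_index /facets_above_facet. Qed.

(** The form exposing the face decomposes over facet normals, and the facets that occur contain the
    face. *)
Lemma face_facets i : fc i = mface u S (nf i).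
Proof.
have [hP _ _] := hB; have [|fi _] := hP (fc i); first by exists i.
have [w ew] := face_minface fi; have [N [NF _] [_ eN]] := minface_rep realizes_base w.
have NP j : j \in N -> j \in facet_indices by apply: (fintype.subsetP NF).
apply/seteqP; split=> x.
  move=> hx; split; first by move: hx; rewrite ew => -[].
  move=> j jn; rewrite minface_normal; last exact: facets_above_index jn.
  by have /facets_aboveP[_] := jn; apply.
move=> hx; rewrite ew eN; apply: mfaceS hx; apply/fintype.subsetP => j jN.
apply/facets_aboveP; split; first exact/facet_indicesP/NP.
by rewrite ew eN => y [_ /(_ j jN)]; rewrite minface_normal //; apply: NP.
Qed.

Lemma facets_above_neq0 i : nf i != finset.set0.
Proof.
have [hP _ _] := hB; have [|_ ni] := hP (fc i); first by exists i.
apply/eqP => e; apply: ni; rewrite face_facets e.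
by apply/seteqP; split=> [x []//|x Px]; split=> // j; rewrite inE.
Qed.

Lemma facets_above_inj : injective nf.
Proof. by move=> i j e; apply: fc_inj; rewrite !face_facets e. Qed.

Lemma compatible_facets_above i : D0 (nf i).
Proof.
split; first by apply/fintype.subsetP => j; apply: facets_above_index.
by rewrite -face_facets; have [hP _ _] := hB; have [|[]] := hP (fc i); first by exists i.
Qed.

Lemma compatible_facet (N : {set I}) i : D0 N -> i \in N -> nf i = [set i]%SET.
Proof. by move=> [/fintype.subsetP NF _] /NF; apply: facets_above_facet. Qed.

(* Condition (2) on building sets, read off the facets containing a face: since
   [S] is simple, the facets containing [F `&` G] are those containing [F] or [G]. *)
Lemma compatible_join i j : nf i :&: nf j != finset.set0 -> D0 (nf i :|: nf j) ->
  exists k, nf k = nf i :|: nf j.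
Proof.
move=> /finset.set0Pn[h]; rewrite inE => /andP[/facets_aboveP[fh sih] /facets_aboveP[_ sjh]].
move=> dij; have [_ [x hx]] := dij.
have eij : mface u S (nf i :|: nf j) = fc i `&` fc j.
  rewrite !face_facets; apply/seteqP; split=> y.
    by move=> hy; split; apply: mfaceS hy; [apply: finset.subsetUl|apply: finset.subsetUr].
  by move=> [[Sy h1] [_ h2]]; split=> // l; rewrite finset.in_setU => /orP[/h1|/h2].
have [_ _ hI] := hB.
have [||||k _ ek] := hI (fc i) (fc j).
- by exists i.
- by exists j.
- by exists x; rewrite -eij.
- by exists (fc h).
exists k; apply/setP => l; rewrite finset.in_setU; apply/idP/idP.
  move=> lk; have [fl sl] := facets_aboveP _ _ lk.
  have dl : D0 [set l]%SET.
    by rewrite -(facets_above_set1 lk); apply: compatible_facets_above.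
  rewrite -finset.in_setU -finset.sub1set; apply: (mface_subset realizes_base dij dl).
  rewrite eij -ek => y /sl ly; split.
    by have [w ew] := face_minface fl.1; move: ly; rewrite ew => -[].
  move=> l'; rewrite finset.in_set1 => /eqP ->; rewrite minface_normal //.
  exact/facet_indicesP.
move=> /orP[] /facets_aboveP[fl sl]; apply/facets_aboveP; split=> //;
  by rewrite ek => y [yi yj]; apply: sl.
Qed.

Lemma dual_lattice_normal i : dual_lattice M (u i).
Proof.
rewrite face_normal_sum; apply: dual_lattice_sum => j /facets_aboveP[fj _].
by have [] := hnu fj.
Qed.

Lemma listing_indices s : inclusion_listing (range fc) s -> exists t : seq I,
  [/\ s = map fc t, uniq t, forall i, i \in t
    & forall i j, nf j \subset nf i -> (index i t <= index j t)%N].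
Proof.
move=> [us es ord]; have [t et] : exists t, s = map fc t.
  have : [set` s] `<=` range fc by rewrite es.
  elim: (s) => [|F r IH] h; first by exists [::].
  have [i _ ei] : range fc F by apply: h; rewrite /= inE eqxx.
  have [|t et] := IH; first by move=> G Gr; apply: h; rewrite /= inE Gr orbT.
  by exists (i :: t); rewrite /= ei et.
have ti i : i \in t.
  have : range fc (fc i) by exists i.
  by rewrite es et /= mem_map.
exists t; split=> //; first by move: us; rewrite et map_inj_uniq.
move=> i j s0; have := ord (fc i) (fc j).
rewrite et !index_map // !mem_map // !ti; apply=> //.
rewrite !face_facets; exact: mfaceS.
Qed.

Lemma T_cone_open_full s Gamma : inclusion_listing (range fc) s ->
    Gamma_fan S nu (range fc) Gamma ->
  [/\ full_dimensional (PL Gamma) (T_cone S nu s),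
      open_polyhedral_cone (PL Gamma) (T_cone S nu s)
    & T_cone S nu s `<=` Def_cone M Gamma].
Proof.
move=> hs [s' hs' ->].
(* The listing of the truncations and that of the fan may differ; both lead to the [nested] complex
   of all indices. *)
have [t [-> ut at_ ot]] := listing_indices hs.
have [t' [-> ut' at' ot']] := listing_indices hs'.
have u_fc i : u i = face_normal S nu (fc i) by [].
have down (N N' : {set I}) : D0 N -> N' \subset N -> D0 N'.
  exact: (rz_down realizes_base).
rewrite (stellar_fan_listing u_fc facets_above_set1 facets_above_neq0 facets_above_inj
  compatible_facets_above down compatible_facet compatible_join realizes_base
  normals_sum face_facets ut' at' ot').
have [pr [prl prL prid]] := exists_lineality_projection p.
have Sy : S (p ord0) by apply: hull_gen.
have TP := T_coneP u_fc fc_inj facets_above_set1 facets_above_neq0 facets_above_inj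
  compatible_facets_above down compatible_facet compatible_join realizes_base
  normals_sum face_facets Sy ut at_ ot prl prL prid.
have stP := fun e Q => shallow_truncationsP u_fc facets_above_set1 facets_above_neq0
  facets_above_inj compatible_facets_above down compatible_facet compatible_join realizes_base
  normals_sum face_facets Sy ut at_ ot (e := e) (Q := Q).
have op := open_projection TP; split=> //.
  apply: open_cone_full op _.
    move=> a f g Wf Wg sg hsg; have [x hx] := Wf sg hsg; have [y hy] := Wg sg hsg.
    by exists (a *: x + y) => v hv; rewrite dotpDr dotpZr hx ?hy.
  have [e [Q hQ]] := exists_truncation u_fc fc_inj facets_above_set1 facets_above_neq0
    facets_above_inj compatible_facets_above down compatible_facet compatible_join
    realizes_base normals_sum face_facets ut at_ ot.
  exists (supp [set 1 *: x + 0 | x in Q]), 1, 0, Q; split=> //; by exists e.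
move=> f [r [v [P [r0 [e he] ->]]]]; have [[rz _] _] := stP e P he.
have rz' := realizes_homothety v r0 rz.
exists (homothety r v P); split=> //.
  exact: realizes_polytope rz' dual_lattice_normal.
rewrite (normal_fan_realizes rz') => _ [N dN <-]; exists [set ucone S u N].
  by move=> _ ->; exists N.
by rewrite bigcup_set1 /ucone lineality_homothety.
Qed.

End Building.

Theorem proposition5p12 (R : realType) (n : nat)
    (M : 'M[R]_n) (hM : M \in unitmx)
    (S : set 'rV[R]_n) (hS : simple_polytope M S)
    (nu : set 'rV[R]_n -> 'rV[R]_n) (hnu : facet_normals M S nu)
    (B : set (set 'rV[R]_n)) (hB : building_set S B)
    (s : seq (set 'rV[R]_n)) (hs : inclusion_listing B s)
    (Gamma : set (set 'rV[R]_n)) (hGamma : Gamma_fan S nu B Gamma) :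
  [/\ full_dimensional (PL Gamma) (T_cone S nu s),
      open_polyhedral_cone (PL Gamma) (T_cone S nu s)
    & T_cone S nu s `<=` Def_cone M Gamma].
Proof.
have [[[m [p eS]] _] _] := hS; subst S.
(* The listing provides the finite index type for the faces in [B]. *)
have eB : B = range (fun i : seq_sub s => val i).
  have [_ -> _] := hs; apply/seteqP; split=> F.
    by move=> Fs; exists (SeqSub Fs).
  by move=> [i _ <-]; apply: valP.
rewrite eB in hB hs hGamma.
exact: (T_cone_open_full hS hnu (@val_inj _ _ _) hB).
Qed.
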